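(* Let $\mathcal{R}=\prod_{i=1}^d\{1,\dots,N_i\}$ be a $d$-dimensional rectangle of integer side-lengths $N_i\ge1$, $i\in\{1,\dots,d\}$, and let $m(\mathcal{R}):=\max_{i=1,\dots,d}\lfloor\log_2 N_i\rfloor$. Let $\boldsymbol{\delta}=(\delta_k)_{k\ge1}$ be a fixed nondecreasing sequence of nonnegative integers such that $$\sum_{k=1}^{m(\mathcal{R})}\delta_k2^{-k}\le\frac{1}{4d^2}.$$ Let $p\in[2,\infty]$ be fixed, and let $(X_t)_{t\in\mathbb{Z}^d}$ be a real-valued integrable random field such that Assumption WD$(p)$ is satisfied, with constant $M_p$ and function $\varphi_p$. Let $S_{\mathcal{R}}:=\sum_{t\in\mathcal{R}}(X_t-\mathbb{E}[X_t])$. - If $p\in[2,\infty)$, then $\|S_{\mathcal{R}}\|_p\le 4\sqrt{p}\,\Psi_p(\boldsymbol{\delta},\mathcal{R})$; - if $p=\infty$, then $\|S_{\mathcal{R}}\|_{\mathrm{SG}}\le 10\,\Psi_\infty(\boldsymbol{\delta},\mathcal{R})$, where (putting $\delta_0=0$) $$\Psi_p(\boldsymbol{\delta},\mathcal{R}):=2M_p\sqrt{|\mathcal{R}|}\left(2+\sum_{k=1}^{m(\mathcal{R})+1}\varphi_p(\delta_{k-1}+1)\sqrt{|\mathcal{C}_k\cap\mathcal{R}|}\right),\qquad \mathcal{C}_k:=\{1,\dots,2^k\}^d.$$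
   Context: All random variables are defined on a probability space $(\Omega,\mathcal{F},\mathbb{P})$; $\|\cdot\|_p$ is the $L^p(\mathbb{P})$ norm; $|A|$ is the cardinality of a finite set $A$. Assumption WD$(p)$: for $t=(t_1,\dots,t_d)\in\mathbb{Z}^d$ and an integer $k>0$, let $\mathcal{M}_{t,k}$ be the $\sigma$-algebra generated by $\{X_u:u=(u_1,\dots,u_d)\in\mathbb{Z}^d,\ \sup_i(t_i-u_i)\ge k\}$. The field satisfies WD$(p)$ if $$\forall t\in\mathbb{Z}^d,\ \forall r>0:\quad\big\|\mathbb{E}[X_t\mid\mathcal{M}_{t,r}]-\mathbb{E}[X_t]\big\|_p\le M_p\,\varphi_p(r)$$ ($r$ ranging over the positive integers), where $\varphi_p(\cdot)$ is a non-increasing function such that $\varphi_p(0)=1$, and $M_p$ is a real constant. Sub-Gaussian norm: for a centered real random variable $Z$, $\|Z\|_{\mathrm{SG}}:=\inf\{c\ge0:\mathbb{E}[\exp(\lambda Z)]\le\exp(\lambda^2c^2/2)\text{ for all }\lambda\in\mathbb{R}\}$.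
   Formalization: The r = 0 case of WD(p), i.e. ‖X_t − E[X_t]‖_p ≤ M_p φ_p(0) = M_p for all t, is added as a hypothesis; with r > 0 only the claim is false (d = 1, N_1 = 1, X_1 a fair sign, other X_t = 0, M_p = 0). *)

(* Defs.v *)
From mathcomp Require Import all_boot all_order all_algebra finmap.
From mathcomp Require Import all_classical all_reals all_analysis.

Set Implicit Arguments.
Unset Strict Implicit.
Unset Printing Implicit Defensive.

Import Order.TTheory GRing.Theory Num.Theory.
Import numFieldNormedType.Exports.

Local Open Scope classical_set_scope.
Local Open Scope ring_scope.

Notation site d := {ffun 'I_d -> int}.

Definition rect (d : nat) (N : 'I_d -> nat) : set (site d) :=
  [set t | forall i, (1 <= t i) && (t i <= (N i)%:Z)].

Definition cube (d k : nat) : set (site d) := rect (fun _ : 'I_d => (2 ^ k)%N).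

Arguments cube : clear implicits.

(* Equal to 0 on infinite sets; only used on subsets of rectangles. *)
Definition card (T : choiceType) (A : set T) : nat := #|` fset_set A|.

(* [trunc_log 2 n] is the integer part of the base-2 logarithm of n >= 1. *)
Definition max_log (d : nat) (N : 'I_d -> nat) : nat :=
  \max_(i < d) trunc_log 2 (N i).

Section RandomField.
Context (disp : measure_display) (T : measurableType disp) (R : realType).
Variable P : probability T R.

Definition centered (X : T -> R) : T -> R := fun w => X w - fine ('E_P[X])%E.

(* Y is a version of the conditional expectation of X given the sub-sigma-algebra
   G of the measurable sets. *)
Definition is_cond_expectation (G : set (set T)) (X Y : T -> R) : Prop :=
  [/\ preimage_set_system setT Y measurable `<=` G,
      P.-integrable setT (EFin \o Y) &
      forall A, G A ->
        (\int[P]_(w in A) (Y w)%:E = \int[P]_(w in A) (X w)%:E)%E].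

(* The sigma-algebra generated by the X u such that the largest of the
   t i - u i is at least k. *)
Definition past (d : nat) (X : site d -> T -> R) (t : site d) (k : nat) :
    set (set T) :=
  <<s \bigcup_(u in [set u : site d | exists i, k%:Z <= t i - u i])
        preimage_set_system setT (X u) measurable >>.

(* Versions of a conditional expectation exist for integrable variables and
   agree almost surely, so the norm does not depend on the choice of Y. *)
Definition WD (d : nat) (X : site d -> T -> R) (p : \bar R) (M : R)
    (phi : nat -> R) : Prop :=
  [/\ forall m n : nat, (m <= n)%N -> phi n <= phi m,
      phi 0%N = 1 &
      forall (t : site d) (r : nat), (0 < r)%N ->
        exists Y : T -> R,
          is_cond_expectation (past X t r) (X t) Y /\
          ('N[P]_p[EFin \o (fun w => (Y w - fine 'E_P[X t])%R)] <= (M * phi r)%:E)%E].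

Definition rect_sum (d : nat) (X : site d -> T -> R) (N : 'I_d -> nat) : T -> R :=
  fun w => \sum_(t \in rect N) centered (X t) w.

(* Infimum in the extended reals: +oo if Z is not sub-Gaussian. *)
Definition subgaussian_norm (Z : T -> R) : \bar R :=
  ereal_inf [set c%:E | c in [set c : R | 0 <= c /\ forall l : R,
    ('E_P[(fun w => expR (l * Z w))%R] <= (expR (l ^+ 2 * c ^+ 2 / 2))%:E)%E]].

End RandomField.

(* delta is meant to satisfy delta 0 = 0. *)
Definition Psi (R : realType) (d : nat) (N : 'I_d -> nat) (delta : nat -> nat)
    (M : R) (phi : nat -> R) : R :=
  2 * M * Num.sqrt (card (rect N))%:R *
  (2 + \sum_(1 <= k < (max_log N).+2)
         phi (delta k.-1 + 1)%N * Num.sqrt (card (cube d k `&` rect N))%:R).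

(* Main.v *)
(* The rectangle is treated by induction over boxes, products of finite sets of
   integers. The points of a box A that come, in one of the coordinates, among
   the first delta_k of a dyadic interval of length 2^k (positions being ranks in
   A) are set aside; they split into d boxes, each with at most |A| / (4 d^2)
   points, so by induction they contribute at most half of the bound. For the
   remaining points, order the dyadic cubes by their Morton code, let W_0 = X and
   let W_(k+1)(x) be the conditional expectation of X(x) given the field on all
   cubes of side 2^k coded before the one containing x. By weak dependence
   |W_(k+1)(x)|_p <= M phi(delta_k + 1), and the sums of W_k - W_(k+1) over cubes
   of side 2^k are martingale differences, to which the L^p martingale inequality
   with constant 2 sqrt p, respectively the Azuma inequality, applies. *)

From HB Require Import structures.
Require Import Defs.
From mathcomp Require Import all_boot all_order all_algebra finmap.
From mathcomp Require Import all_classical all_reals all_analysis.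
From mathcomp Require Import measurable_realfun ess_sup_inf.
From mathcomp Require Import ring lra zify.

Set Implicit Arguments.
Unset Strict Implicit.
Unset Printing Implicit Defensive.

Import Order.TTheory GRing.Theory Num.Theory.
Import numFieldNormedType.Exports.

Local Open Scope ring_scope.

(** * Dyadic combinatorics of boxes *)

Section Morton.
Local Open Scope nat_scope.

(** A point and its predecessors in the code may be neighbours in Z^d, so without removing points
    the conditional expectations would only decay like [phi 1] at every scale. Setting aside the
    start of the dyadic intervals buys the distance [delta k + 1]. What remains is no longer a
    product of intervals, so the induction runs over products of arbitrary finite sets: a difference
    of ranks never exceeds the difference of the integers, hence separation in rank is separation on
    the lattice. The past in WD asks for a single coordinate that is small enough; an order
    extending the coordinatewise one provides it, since an earlier cube must be smaller in some
    coordinate. The hypothesis 1/(4 d^2) is the square of 1/(2 d): the bound scales like the square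
    root of the cardinality, each of the d boxes set aside costs 1/(2 d) of it, and the induction
    closes with a factor 2, the solution of c = c/2 + 1. Together with 2 sqrt p this gives 4 sqrt p;
    with the constant 1 of Azuma it gives 2, within the stated 10. *)

Definition digit d (b : 'I_d -> nat) : nat := \sum_(i < d) b i * 2 ^ i.

Lemma digitS d (b : 'I_d.+1 -> nat) :
  digit b = b ord0 + 2 * digit (fun i => b (lift ord0 i)).
Proof.
rewrite /digit big_ord_recl muln1 big_distrr /=; congr (_ + _).
by apply: eq_bigr => i _; rewrite /bump add1n expnS mulnCA.
Qed.

Lemma digit_lt d (b : 'I_d -> nat) : (forall i, b i < 2) -> digit b < 2 ^ d.
Proof.
elim: d b => [|d IH] b b2; first by rewrite /digit big_ord0.
rewrite digitS expnS.
move: (IH (fun i => b (lift ord0 i)) (fun i => b2 (lift ord0 i))) (b2 ord0).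
by move: (digit _) (b ord0) (2 ^ d) => p q r; lia.
Qed.

Lemma digit_inj d (b c : 'I_d -> nat) : (forall i, b i < 2) -> (forall i, c i < 2) ->
  digit b = digit c -> b =1 c.
Proof.
elim: d b c => [|d IH] b c b2 c2; first by move=> _ [].
rewrite !digitS => E i.
have [E0 E1] : b ord0 = c ord0 /\
    digit (fun i => b (lift ord0 i)) = digit (fun i => c (lift ord0 i)).
  move: E (b2 ord0) (c2 ord0); set p := digit _; set q := digit _.
  by move: (b ord0) (c ord0) p q => b0 c0 p q *; split; lia.
case: (unliftP ord0 i) => [j ->|->]//.
by apply: (IH (fun i => b (lift ord0 i)) (fun i => c (lift ord0 i))).
Qed.

(* Z-order: interleaving the binary digits of the coordinates makes the quotients
   of the code by [2 ^ (d * k)] index the dyadic cubes of side [2 ^ k], in an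
   order that extends the coordinatewise one. *)
Fixpoint morton d (K : nat) (x : 'I_d -> nat) : nat :=
  if K is K'.+1 then
    morton K' (fun i => x i %/ 2) * 2 ^ d + digit (fun i => x i %% 2)
  else 0.

Lemma eq_morton d K (x y : 'I_d -> nat) : x =1 y -> morton K x = morton K y.
Proof. by move=> xy; congr morton; apply/funext. Qed.

Lemma mod2_lt d (x : 'I_d -> nat) i : x i %% 2 < 2.
Proof. by rewrite ltn_mod. Qed.

Lemma morton_lt d K (x : 'I_d -> nat) : morton K x < 2 ^ (d * K).
Proof.
elim: K x => [|K IH] x /=; first by rewrite muln0.
rewrite mulnS expnD.
move: (IH (fun i => x i %/ 2)) (digit_lt (mod2_lt x)).
by move: (morton _ _) (digit _) (2 ^ d) (2 ^ (d * K)) => p q r s; nia.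
Qed.

(** The last [d * k] binary digits of the code come from the last [k] digits of the coordinates, so
    discarding them divides every coordinate by [2 ^ k]. *)
Lemma morton_div d K k (x : 'I_d -> nat) : k <= K ->
  morton K x %/ 2 ^ (d * k) = morton (K - k) (fun i => x i %/ 2 ^ k).
Proof.
elim: k K x => [|k IH] K x kK.
  rewrite muln0 divn1 subn0; apply: eq_morton => i; by rewrite divn1.
case: K kK => // K kK /=.
rewrite mulnS expnD divnMA divnMDl ?expn_gt0// (divn_small (digit_lt (mod2_lt x))) addn0.
rewrite IH// subSS; apply: eq_morton => i.
by rewrite -divnMA -expnS.
Qed.

Lemma morton_inj d K (x y : 'I_d -> nat) :
  (forall i, x i < 2 ^ K) -> (forall i, y i < 2 ^ K) ->
  morton K x = morton K y -> x =1 y.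
Proof.
elim: K x y => [|K IH] x y xK yK /=.
  by move=> _ i; move: (xK i) (yK i); rewrite expn0 !ltnS !leqn0 => /eqP-> /eqP->.
move=> E i.
have dx := digit_lt (mod2_lt x); have dy := digit_lt (mod2_lt y).
have E1 : morton K (fun i => x i %/ 2) = morton K (fun i => y i %/ 2) by nia.
have E2 : digit (fun i => x i %% 2) = digit (fun i => y i %% 2) by nia.
have H z : (forall i, z i < 2 ^ K.+1) -> forall i : 'I_d, z i %/ 2 < 2 ^ K.
  by move=> zK j; rewrite ltn_divLR// mulnC -expnS.
have := IH _ _ (H x xK) (H y yK) E1 i.
have := digit_inj (mod2_lt x) (mod2_lt y) E2 i.
by move=> e1 e2; rewrite (divn_eq (x i) 2) (divn_eq (y i) 2) e1 e2.
Qed.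

(** The leading digits decide. If the codes of the halved points tie, [morton_inj] equates these
    points coordinate by coordinate, and only the parities are left to compare. *)
Lemma morton_mono d K (x y : 'I_d -> nat) :
  (forall i, x i < 2 ^ K) -> (forall i, y i < 2 ^ K) ->
  (forall i, x i <= y i) -> morton K x <= morton K y.
Proof.
elim: K x y => [|K IH] x y xK yK xy //=.
have H z : (forall i, z i < 2 ^ K.+1) -> forall i : 'I_d, z i %/ 2 < 2 ^ K.
  by move=> zK j; rewrite ltn_divLR// mulnC -expnS.
have le := IH _ _ (H x xK) (H y yK) (fun i => leq_div2r 2 (xy i)).
have dx := digit_lt (mod2_lt x); have dy := digit_lt (mod2_lt y).
move: le; rewrite leq_eqVlt => /predU1P[E|lt]; last by nia.
rewrite E leq_add2l; apply: leq_sum => i _; rewrite leq_mul2r.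
have := morton_inj (H x xK) (H y yK) E i => e.
by have := xy i; rewrite {1}(divn_eq (x i) 2) {1}(divn_eq (y i) 2) e leq_add2l => ->;
  rewrite orbT.
Qed.

End Morton.

Section Rank.
Local Open Scope nat_scope.
Variable n : nat.
Implicit Types (A : {set 'I_n}) (a b : 'I_n).

Definition rank_in A a : nat := #|[set b in A | b < a]|.

Lemma rank_in_lt_card A a : a \in A -> rank_in A a < #|A|.
Proof.
move=> aA; apply: proper_card; apply/properP; split.
  by apply/fintype.subsetP => b; rewrite inE => /andP[].
by exists a => //; rewrite inE ltnn andbF.
Qed.

Lemma rank_in_ltn A a b : a \in A -> a < b -> rank_in A a < rank_in A b.
Proof.
move=> aA ab; apply: proper_card; apply/properP; split.
  by apply/fintype.subsetP => c; rewrite !inE => /andP[-> ca]; exact: ltn_trans ab.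
by exists a; rewrite !inE aA ?ab ?ltnn.
Qed.

Lemma rank_in_inj A : {in A &, injective (rank_in A)}.
Proof.
move=> a b aA bA E; apply/val_inj => /=.
case: (ltngtP a b) => // h; [have := rank_in_ltn aA h|have := rank_in_ltn bA h];
  by rewrite E ltnn.
Qed.

(** Each rank gained between [a] and [b] uses up an element of [A] in [[a, b[]. For [b <= a] the
    truncated subtraction turns this into monotonicity. *)
Lemma rank_in_sub A a b : rank_in A b <= rank_in A a + (b - a).
Proof.
pose I := [set c : 'I_n | a <= c < b].
have cI : #|I| <= b - a.
  rewrite -[b - a]card_ord -[#|'I_(b - a)|]cardsT.
  have [/eqP I0|I0] := boolP (I == finset.set0); first by rewrite I0 cards0.
  have ba : 0 < b - a.
    case/finset.set0Pn : I0 => c; rewrite inE => /andP[h1 h2]; lia.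
  have E : (b - a).-1.+1 = b - a by lia.
  rewrite -E.
  pose f (c : 'I_n) : 'I_(b - a).-1.+1 := inord (c - a).
  rewrite -(@card_in_imset _ _ f); first exact/subset_leq_card/fintype.subsetP.
  move=> c c'; rewrite !inE => /andP[h1 h2] /andP[h3 h4] /(congr1 val) /=.
  rewrite !inordK; [|lia|lia] => h; apply/val_inj => /=; lia.
apply: (@leq_trans (#|[set c in A | c < a]| + #|I|)); last by rewrite leq_add2l.
apply: leq_trans (leq_card_setU _ _); apply: subset_leq_card; apply/fintype.subsetP => c.
by rewrite !inE => /andP[-> cb] /=; rewrite cb andbT; case: ltnP.
Qed.

(** Ranks embed [A] into ['I_#|A|], so sets defined by positions are counted by arithmetic alone. *)
Lemma card_rank_in_le A (p : pred nat) :
  #|[set a in A | p (rank_in A a)]| <= #|[set r : 'I_#|A| | p r]|.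
Proof.
have [A0|/card_gt0P[a0 a0A]] := posnP #|A|.
  move/eqP : A0; rewrite cards_eq0 => /eqP ->.
  by rewrite (_ : [set a in finset.set0 | _] = finset.set0) ?cards0//;
    apply/finset.setP => a; rewrite !inE.
have E : #|A|.-1.+1 = #|A| by rewrite prednK//; apply/card_gt0P; exists a0.
suff : #|[set a in A | p (rank_in A a)]| <=
  #|[set r : 'I_(#|A|.-1.+1) | p r]| by rewrite E.
pose f (a : 'I_n) : 'I_#|A|.-1.+1 := inord (rank_in A a).
have fE a : a \in A -> f a = rank_in A a :> nat.
  by move=> aA; rewrite /f inordK// E rank_in_lt_card.
rewrite -(@card_in_imset _ _ f).
  apply: subset_leq_card; apply/fintype.subsetP => _ /imsetP[a + ->].
  by rewrite !inE => /andP[aA pa]; rewrite fE.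
move=> a b; rewrite !inE => /andP[aA _] /andP[bA _] /(congr1 val) /=.
by rewrite !fE//; exact: rank_in_inj.
Qed.

Lemma card_div_le m D q : 0 < D -> #|[set r : 'I_m | r %/ D == q]| <= D.
Proof.
case: D => // D _; rewrite -[X in _ <= X]card_ord -cardsT.
pose f (r : 'I_m) : 'I_D.+1 := inord (r %% D.+1).
rewrite -(@card_in_imset _ _ f); first exact/subset_leq_card/fintype.subsetP.
move=> a b; rewrite !inE => /eqP aq /eqP bq /(congr1 val) /=.
rewrite !inordK ?ltn_mod// => h; apply/val_inj => /=.
by rewrite (divn_eq a D.+1) (divn_eq b D.+1) aq bq h.
Qed.

(** As interval 0 is excluded, the quotient [r %/ D] runs through 1, ..., [m %/ D]: the possibly
    incomplete last interval takes the place of the first one. Each interval holds at most [e] such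
    points, hence at most [e * (m %/ D)] in all. *)
Lemma card_gap_le m D e : 0 < D ->
  #|[set r : 'I_m | (D <= r) && (r %% D < e)]| * D <= e * m.
Proof.
move=> D0.
suff h : #|[set r : 'I_m | (D <= r) && (r %% D < e)]| <= e * (m %/ D).
  rewrite (leq_trans (leq_mul h (leqnn D)))// -mulnA leq_mul2l.
  by rewrite leq_trunc_div orbT.
case: e => [|e].
  by rewrite (_ : [set r : 'I_m | _] = finset.set0) ?cards0//; apply/finset.setP => r;
    rewrite !inE ltn0 andbF.
have [/eqP mD|mD] := eqVneq (m %/ D) 0.
  rewrite (_ : [set r : 'I_m | _] = finset.set0) ?cards0//; apply/finset.setP => r;
    rewrite !inE.
  move: mD; rewrite -leqn0 leqNgt divn_gt0// -ltnNge => mD.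
  by rewrite leqNgt (ltn_trans (ltn_ord r) mD).
have E : (m %/ D).-1.+1 = m %/ D by rewrite prednK// lt0n.
rewrite -E.
have -> : e.+1 * (m %/ D).-1.+1 = #|[set: 'I_e.+1 * 'I_(m %/ D).-1.+1]|.
  by rewrite cardsT card_prod !card_ord.
pose f (r : 'I_m) : 'I_e.+1 * 'I_(m %/ D).-1.+1 := (inord (r %% D), inord (r %/ D).-1).
rewrite -(@card_in_imset _ _ f); first exact/subset_leq_card/fintype.subsetP.
move=> a b; rewrite !inE =>
  /andP[aD ae] /andP[bD be] [/(congr1 val)/= h1 /(congr1 val)/=].
have H (r : 'I_m) : D <= r -> (0 < r %/ D) /\ (r %/ D).-1 < (m %/ D).-1.+1.
  move=> Dr; have r0 : 0 < r %/ D by rewrite divn_gt0.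
  split=> //; rewrite E; have := leq_div2r D (ltnW (ltn_ord r)); lia.
have [a0 aE] := H a aD; have [b0 bE] := H b bD.
rewrite !inordK// => h2; move: h1; rewrite !inordK// => h1.
apply/val_inj => /=; rewrite (divn_eq a D) (divn_eq b D) h1.
by rewrite -(prednK a0) -(prednK b0) h2.
Qed.

End Rank.

Section Boxes.
Local Open Scope nat_scope.
Variables (d n : nat).
Implicit Types (A B : 'I_d -> {set 'I_n}) (x u : {ffun 'I_d -> 'I_n}).

Definition box A : {set {ffun 'I_d -> 'I_n}} := [set x : {ffun 'I_d ->
  'I_n} | [forall i, x i \in A i]].

Lemma boxP A x : reflect (forall i, x i \in A i) (x \in box A).
Proof. by rewrite inE; exact: forallP. Qed.

Lemma card_box A : #|box A| = \prod_i #|A i|.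
Proof.
rewrite -(big_enum _ _ _ (fun i => #|A i|)) -(big_map (fun i =>
  #|A i|) xpredT id) -foldrE.
rewrite -(card_family (fun i => mem (A i))) cardsE; apply: eq_card => x.
by apply/forallP/familyP.
Qed.

Variable K : nat.

Definition zcode A x := morton K (fun i => rank_in (A i) (x i)).

Lemma rank_in_box A x i : x \in box A -> (forall i, #|A i| <= 2 ^ K) ->
  rank_in (A i) (x i) < 2 ^ K.
Proof.
by move=> /boxP xA AK; rewrite (leq_trans (rank_in_lt_card (xA i))).
Qed.

Lemma rank_in_div_box A x i k : k <= K -> x \in box A -> (forall i, #|A i| <= 2 ^ K) ->
  rank_in (A i) (x i) %/ 2 ^ k < 2 ^ (K - k).
Proof.
move=> kK xA AK; rewrite ltn_divLR ?expn_gt0// -expnD subnK//; exact: rank_in_box.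
Qed.

(** Once a point [y] of the block is fixed, [morton_inj] confines the other points to the dyadic
    intervals of ranks around the coordinates of [y], and these form a box. *)
Lemma zcode_block_card A k j : k <= K -> (forall i, #|A i| <= 2 ^ K) ->
  #|[set x in box A | zcode A x %/ 2 ^ (d * k) == j]| <= \prod_i minn (2 ^ k) #|A i|.
Proof.
move=> kK AK; set B := [set x in _ | _].
have [->|/finset.set0Pn[y]] := eqVneq B finset.set0; first by rewrite cards0.
rewrite inE => /andP[yA /eqP yj].
pose C i := [set a in A i | rank_in (A i) a %/ 2 ^ k == rank_in (A i) (y i) %/ 2 ^ k].
apply: (@leq_trans #|box C|).
  apply: subset_leq_card; apply/fintype.subsetP => x.
  rewrite inE -yj => /andP[xA]; rewrite !morton_div// => /eqP E.
  have EE := morton_inj (fun i => rank_in_div_box i kK xA AK) (fun i =>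
    rank_in_div_box i kK yA AK) E.
  by apply/boxP => i; rewrite inE (boxP _ _ xA) EE eqxx.
rewrite card_box; apply: leq_prod => i _.
rewrite leq_min; apply/andP; split.
  apply: leq_trans (card_div_le #|A i| (rank_in (A i) (y i) %/ 2 ^ k) _);
    last by rewrite expn_gt0.
  exact: (card_rank_in_le (A i) (fun r => r %/ 2 ^ k == rank_in (A i) (y i) %/ 2 ^ k)).
by apply: subset_leq_card; apply/fintype.subsetP => a; rewrite inE => /andP[].
Qed.

(** Contraposition of [morton_mono], applied to the block indices. *)
Lemma zcode_past A k x u : k <= K -> (forall i, #|A i| <= 2 ^ K) ->
  x \in box A -> u \in box A ->
  zcode A u %/ 2 ^ (d * k) < zcode A x %/ 2 ^ (d * k) ->
  exists i, rank_in (A i) (u i) %/ 2 ^ k < rank_in (A i) (x i) %/ 2 ^ k.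
Proof.
move=> kK AK xA uA; rewrite !morton_div// => lt.
apply/existsP; rewrite -[X in is_true X]negbK negb_exists; apply/negP => /forallP h.
move: lt; rewrite ltnNge => /negP; apply; apply: morton_mono.
- by move=> i; exact: rank_in_div_box.
- by move=> i; exact: rank_in_div_box.
- by move=> i; have := h i; rewrite -leqNgt.
Qed.

Variables (delta : nat -> nat) (m : nat).

(* The first interval of each length is kept whole: it has no predecessor to be
   separated from, which is why the count below needs no rounding up. *)
Definition gap (S : {set 'I_n}) : {set 'I_n} :=
  [set a in S | [exists k : 'I_m, (2 ^ k.+1 <=
    rank_in S a) && (rank_in S a %% 2 ^ k.+1 < delta k.+1)]].

Lemma gap_sub S : gap S \subset S.
Proof. by apply/fintype.subsetP => a; rewrite inE => /andP[]. Qed.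

Lemma core_separated A k x u : delta 0 = 0 -> k <= m -> k <= K ->
  (forall i, #|A i| <= 2 ^ K) ->
  x \in box (fun i => A i :\: gap (A i)) -> u \in box A ->
  zcode A u %/ 2 ^ (d * k) < zcode A x %/ 2 ^ (d * k) ->
  exists i, u i + (delta k + 1) <= x i.
Proof.
move=> d0 km kK AK /boxP xC uA lt.
have xA : x \in box A by apply/boxP => i; have := xC i; rewrite inE => /andP[].
have [i hi] := zcode_past kK AK xA uA lt; exists i.
have D0 : 0 < 2 ^ k by rewrite expn_gt0.
(* An interval that follows another one is not the first of its length, so the exemption in [gap]
   does not cover [x]. *)
have big : 2 ^ k <= rank_in (A i) (x i).
  rewrite leqNgt; apply/negP => /divn_small e; by rewrite e in hi.
have dk : delta k <= rank_in (A i) (x i) %% 2 ^ k.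
  (* [gap] starts at length 2; at scale 0 the intervals are single ranks and [delta 0 = 0] leaves
     nothing to remove. *)
  case: k km kK lt hi D0 big => [|k] km kK lt hi D0 big; first by rewrite d0.
  have := xC i; rewrite !inE => /andP[+ xi]; rewrite xi/= => /existsPn /(_ (Ordinal km)).
  by rewrite /= big/= -leqNgt.
have ub : rank_in (A i) (u i) < rank_in (A i)
  (x i) %/ 2 ^ k * 2 ^ k by rewrite -ltn_divLR.
have sub := rank_in_sub (A i) (u i) (x i).
have := divn_eq (rank_in (A i) (x i)) (2 ^ k).
lia.
Qed.

Lemma card_gap (R : realType) S :
  (#|gap S|%:R <= #|S|%:R * \sum_(1 <= k < m.+1) (delta k)%:R / 2 ^+ k :> R)%R.
Proof.
have h : #|gap S| <= \sum_(k < m) #|[set r : 'I_#|S| | (2 ^ k.+1 <=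
  r) && (r %% 2 ^ k.+1 < delta k.+1)]|.
  apply: (@leq_trans (\sum_(k < m) #|[set a in S | (2 ^ k.+1 <=
    rank_in S a) && (rank_in S a %% 2 ^ k.+1 < delta k.+1)]|)).
    have -> : gap S = \bigcup_(k < m) [set a in S | (2 ^ k.+1 <=
      rank_in S a) && (rank_in S a %% 2 ^ k.+1 < delta k.+1)].
      apply/finset.setP => a; rewrite inE;
        apply/andP/finset.bigcupP => [[aS /existsP[k hk]]|[k _]].
        by exists k => //; rewrite inE aS.
      by rewrite inE => /andP[aS hk]; split=> //; apply/existsP; exists k.
    elim/big_rec2 : _ => [|k a B _ h]; first by rewrite cards0.
    by rewrite (leq_trans (leq_card_setU _ _))// leq_add2l.
  apply: leq_sum => k _.
  exact: (card_rank_in_le S (fun r => (2 ^ k.+1 <= r) && (r %% 2 ^ k.+1 < delta k.+1))).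
rewrite (le_trans (_ : _ <= (\sum_(k < m) #|[set r : 'I_#|S| | (2 ^ k.+1 <=
  r) && (r %% 2 ^ k.+1 < delta k.+1)]|)%:R)%R) ?ler_nat//.
rewrite natr_sum big_add1/= big_mkord mulr_sumr; apply: ler_sum => k _.
rewrite mulrA ler_pdivlMr ?exprn_gt0//.
rewrite -natrX -!natrM ler_nat [X in _ <= X]mulnC; apply: card_gap_le.
by rewrite expn_gt0.
Qed.

End Boxes.

Local Open Scope classical_set_scope.

(** * Real inequalities *)

Section RealInequalities.
Variable R : realType.
Implicit Types x y z : R.

Lemma derive_ge0_le (f df : R -> R) x : 0 <= x ->
  (forall y, is_derive y (1 : R) f (df y)) -> (forall y, 0 <= y -> 0 <= df y) ->
  f 0 <= f x.
Proof.
move=> x0 fdf df0.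
have [|y yI E] := @MVT_segment R f df 0 x x0 (fun y _ => fdf y).
  apply: derivable_within_continuous => y _; exact: ex_derive.
rewrite -subr_ge0 E mulr_ge0 ?subr0//; apply: df0.
by move: yI; rewrite in_itv/= => /andP[].
Qed.

(** This is tanh z <= z cleared of denominators. The derivative of the difference is nonnegative
    because exp(-2y) >= 1 - 2y. *)
Lemma expR2_mul_le z : 0 <= z -> (1 - z) * expR (z *+ 2) <= 1 + z.
Proof.
move=> z0.
pose f y := 1 + y - (1 - y) * expR (y *+ 2).
have : f 0 <= f z.
  apply: (@derive_ge0_le f (fun y => 1 - expR (y *+ 2) * (1 - y *+ 2))) => //.
    move=> y; apply: is_derive_eq.
    rewrite /GRing.scale/=. ring.
  move=> y y0; rewrite subr_ge0.
  have := ler_wpM2l (expR_ge0 (y *+ 2)) (expR_ge1Dx (- (y *+ 2))).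
  by rewrite expRN mulfV ?gt_eqF ?expR_gt0.
by rewrite /f mul0rn expR0 subr0 mulr1 addr0 subrr; lra.
Qed.

(** The function cosh(y) exp(-y^2/2) is nonincreasing for y >= 0, its logarithmic derivative being
    tanh(y) - y; it equals 1 at 0. *)
Lemma cosh_le_expR z : expR z + expR (- z) <= 2 * expR (z ^+ 2 / 2).
Proof.
wlog z0 : z / 0 <= z.
  move=> H; have [|/ltW z0] := leP 0 z; first exact: H.
  by rewrite addrC -{2}(opprK z) -sqrrN; apply: H; rewrite oppr_ge0.
pose f y := - (expR (y - y ^+ 2 / 2) + expR (- y - y ^+ 2 / 2)).
pose df y := expR (- y - y ^+ 2 / 2) * (1 + y) - (1 - y) * expR (y - y ^+ 2 / 2).
have : f 0 <= f z.
  apply: (@derive_ge0_le f df) => //.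
    move=> y; apply: is_derive_eq.
    rewrite /df /GRing.scale/=; by field.
  move=> y y0; rewrite /df subr_ge0.
  rewrite (_ : y - y ^+ 2 / 2 = - y - y ^+ 2 / 2 + y *+ 2); last by lra.
  by rewrite expRD mulrCA ler_wpM2l ?expR_ge0 ?expR2_mul_le.
rewrite /f oppr0 expr0n/= mul0r subr0 expR0 lerN2 !expRD -mulrDl (expRN (z ^+ 2 / 2)).
rewrite ler_pdivrMr ?expR_gt0//; lra.
Qed.

(** Convexity places [expR] below its chord over [0, 1], whose slope e - 1 is at most 2. *)
Lemma expR_le_affine (u : R) : 0 <= u <= 1 -> expR u <= 1 + 2 * u.
Proof.
move=> u01.
have e3 : expR (1 : R) <= 3.
  (* Inverse of exp(-1/8) >= 7/8; the eighth power of 8/7 is still below 3. *)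
  have h : expR (1 / 8 : R) <= 8 / 7.
    have := expR_ge1Dx (- (1 / 8) : R).
    rewrite expRN => h.
    have e0 := expR_gt0 (1 / 8 : R).
    have := ler_wpM2l (ltW e0) h. rewrite mulfV ?gt_eqF//. lra.
  rewrite (_ : (1 : R) = 8%:R * (1 / 8)); last by field.
  rewrite expRM_natl.
  apply: (le_trans (lerXn2r 8 _ _ h)); rewrite ?nnegrE ?expR_ge0//.
  lra.
have /= := @convex_expR R (Itv01 (proj1 (andP u01)) (proj2 (andP u01))) 1 0.
rewrite !convRE /= mulr1 mulr0 addr0 expR0 /unstable.onem.
case/andP: u01 => u0 u1.
have := ler_wpM2l u0 e3. lra.
Qed.

(* Two-uniform smoothness of [L^p] with constant [2 * p] instead of the optimal
   [p - 1], which leaves room for a proof by cases on [p * y ^+ 2 < x ^+ 2]. *)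
Lemma two_point (p x y : R) : 2 <= p ->
  `|x + y| `^ p + `|x - y| `^ p <= 2 * (x ^+ 2 + 2 * p * y ^+ 2) `^ (p / 2).
Proof.
move=> p2; have p0 : 0 < p by lra.
have sqE a : `|a| `^ p = (a ^+ 2) `^ (p / 2).
  rewrite -real_normK ?num_real// -powR_mulrn// -powRrM; congr (_ `^ _); by field.
(* If x^2 <= p y^2, each term is bounded separately: (x + y)^2 and (x - y)^2 are at most 2 x^2 + 2
   y^2 <= x^2 + (p + 2) y^2 <= x^2 + 2 p y^2. *)
have [h|h] := leP (x ^+ 2) (p * y ^+ 2).
  have H b : b ^+ 2 <= x ^+ 2 + 2 * p * y ^+ 2 -> `|b| `^ p <=
    (x ^+ 2 + 2 * p * y ^+ 2) `^ (p / 2).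
    move=> hb; have p20 : 0 <= p / 2 by lra.
    rewrite sqE ge0_ler_powR// nnegrE; first exact: sqr_ge0.
    exact: le_trans (sqr_ge0 b) hb.
  have h1 := H (x + y); have h2 := H (x - y).
  suff : (x + y) ^+ 2 <= x ^+ 2 + 2 * p * y ^+ 2 /\ (x - y) ^+ 2 <=
    x ^+ 2 + 2 * p * y ^+ 2.
    by move=> [/h1 ? /h2 ?]; lra.
  have := sqr_ge0 (x + y); have := sqr_ge0 (x - y); have := sqr_ge0 y.
  split; nra.
have x0 : x != 0.
  apply/eqP => x0; move: h; rewrite x0 expr0n/= => h.
  have := sqr_ge0 y; nra.
(* In the other case p t^2 < 1, and (1 + t)^p + (1 - t)^p <= 2 cosh(p t) <= 2 exp(p t^2)^(p/2),
   where exp(p t^2) <= 1 + 2 p t^2 by [expR_le_affine]. *)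
pose t := y / x.
have yE : y = t * x by rewrite /t divfK.
have x2 : 0 < x ^+ 2 by rewrite exprn_even_gt0.
have u1 : p * t ^+ 2 < 1.
  rewrite -(ltr_pM2r x2) mul1r; move: h; rewrite {1}yE; lra.
have t1 : t ^+ 2 < 1 by have := sqr_ge0 t; nra.
have tI : -1 < t < 1 by apply/andP; split; nra.
have B s : -1 < s -> `|1 + s| `^ p <= expR (p * s).
  move=> s1; rewrite mulrC expRM ge0_ler_powR ?nnegrE ?expR_ge0//; first exact: ltW.
  by rewrite ger0_norm; [exact: expR_ge1Dx|lra].
have E1 s : `|x + s * x| `^ p = `|x| `^ p * `|1 + s| `^ p.
  by rewrite -powRM// -normrM; congr (`|_| `^ _); ring.
have E2 : (x ^+ 2 + 2 * p * y ^+ 2) `^ (p / 2) = `|x| `^ p * (1 + 2 * (p * t ^+ 2)) `^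
  (p / 2).
  have := sqr_ge0 t => t20.
  rewrite sqE -powRM; [|exact: ltW|nra].
  by congr (_ `^ _); rewrite yE; ring.
rewrite E2 yE -mulNr !E1 -mulrDr mulrCA ler_wpM2l ?powR_ge0//.
have b1 := B t; have b2 := B (- t).
have c := cosh_le_expR (p * t).
have eu : expR (p * t ^+ 2) <= 1 + 2 * (p * t ^+ 2).
  by apply: expR_le_affine; have := sqr_ge0 t; nra.
have eu' : expR ((p * t) ^+ 2 / 2) <= (1 + 2 * (p * t ^+ 2)) `^ (p / 2).
  rewrite (_ : (p * t) ^+ 2 / 2 = p * t ^+ 2 * (p / 2)); last by field.
  rewrite expRM ge0_ler_powR ?nnegrE ?expR_ge0//; first lra.
  by have := sqr_ge0 t; nra.
rewrite -mulrN in c.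
have := b1; have := b2; lra.
Qed.
End RealInequalities.

(** * Conditional expectation *)

Section SubSigmaAlgebra.
Context (disp : measure_display) (T : measurableType disp) (R : realType).
Variable P : probability T R.
Implicit Types (G : set (set T)) (f g D : T -> R).

Definition measurable_wrt G f :=
  measurable_fun [set: g_sigma_algebraType G] (f : g_sigma_algebraType G -> R).

(* [D] has conditional expectation 0 given [<<s G >>]. *)
Definition cond_centered G D := P.-integrable setT (EFin \o D) /\
  forall A, <<s G >> A -> (\int[P]_(w in A) (D w)%:E = 0)%E.

Lemma subalgebra_measurable G A : G `<=` measurable -> <<s G >> A -> measurable A.
Proof.
move=> GT; apply: smallest_sub => //.
exact: sigma_algebra_measurable.
Qed.

Lemma measurable_wrt_preimage G f B : measurable_wrt G f -> measurable B ->
  <<s G >> (f @^-1` B).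
Proof.
by move=> mf mB; have := mf measurableT _ mB; rewrite setTI.
Qed.

Lemma measurable_wrtP G f :
  (forall B, measurable B -> <<s G >> (f @^-1` B)) -> measurable_wrt G f.
Proof. by move=> h _ B mB; rewrite setTI; exact: h. Qed.

Lemma measurable_wrt_measurable G f : G `<=` measurable -> measurable_wrt G f ->
  measurable_fun setT f.
Proof.
move=> GT mf _ B mB; rewrite setTI.
exact: (subalgebra_measurable GT (measurable_wrt_preimage mf mB)).
Qed.

Lemma measurable_wrtW G H f : G `<=` <<s H >> -> measurable_wrt G f -> measurable_wrt H f.
Proof.
move=> GH mf; apply: measurable_wrtP => B mB.
have : <<s G >> (f @^-1` B) by exact: measurable_wrt_preimage.
apply: smallest_sub => //; exact: smallest_sigma_algebra.
Qed.

Lemma cond_centeredW G H D : H `<=` <<s G >> -> cond_centered G D -> cond_centered H D.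
Proof.
move=> HG [iD oD]; split=> // A HA; apply: oD; move: HA.
by apply: smallest_sub => //; exact: smallest_sigma_algebra.
Qed.

Lemma cond_centeredD G D1 D2 : G `<=` measurable -> cond_centered G D1 ->
  cond_centered G D2 ->
  cond_centered G (D1 \+ D2).
Proof.
move=> GT [i1 o1] [i2 o2]; split.
  rewrite (_ : _ \o _ = (EFin \o D1) \+ (EFin \o D2))%E//.
  exact: integrableD.
move=> A GA; have mA := subalgebra_measurable GT GA.
under eq_integral do rewrite /= EFinD.
rewrite integralD//;
  [|exact: (integrableS measurableT mA (@subsetT _ _) i1)|exact:
    (integrableS measurableT mA (@subsetT _ _) i2)].
by rewrite o1// o2// adde0.
Qed.

Lemma cond_centeredN G D : G `<=` measurable -> cond_centered G D ->
  cond_centered G (\- D).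
Proof.
move=> GT [i1 o1]; split.
  rewrite (_ : _ \o _ = (fun x => - (EFin \o D) x)%E)//.
  exact: integrableN.
move=> A GA; have mA := subalgebra_measurable GT GA.
under eq_integral do rewrite /= EFinN.
rewrite integralN; first by rewrite o1// oppe0.
apply: integrable_add_def => //.
exact: (integrableS measurableT mA (@subsetT _ _) i1).
Qed.

Lemma cond_centered0 G : cond_centered G (fun=> 0).
Proof.
split; first exact: integrable0.
by move=> A _; rewrite integral0.
Qed.

(** Pushing forward along the identity into [g_sigma_algebraType G] restricts both [P] and the
    charge of density [f] to [<<s G >>]. The Radon-Nikodym derivative taken there is measurable for
    the smaller sigma-algebra, as required. *)
Lemma cond_expectation_ex G f : G `<=` measurable ->
  P.-integrable setT (EFin \o f) ->
  exists2 Y, measurable_wrt G Y & cond_centered G (f \- Y).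
Proof.
move=> GT fi.
pose T' := g_sigma_algebraType G.
pose i : T -> T' := id.
have mi : measurable_fun setT i.
  by move=> _ B mB; rewrite setTI; exact: (subalgebra_measurable GT).
pose iM : {mfun T >-> T'} := HB.pack i (isMeasurableFun.Build _ _ _ _ i mi).
pose mu : probability T' R := distribution P iM.
pose nu : {charge set T' -> \bar R} :=
  measure_function_pushforward__canonical__charge_Charge (induced_charge fi) mi.
have numu : nu `<< mu.
  apply/null_content_dominatesP => A mA muA.
  have mA' : measurable (A : set T) by exact: (subalgebra_measurable GT).
  apply: null_set_integral => //.
  by have /measurable_int := fi; exact: measurable_funS.
have iY := Radon_Nikodym_integrable numu.
pose Y := fine \o Radon_Nikodym nu mu.
have YE : EFin \o Y = Radon_Nikodym nu mu.
  by apply/funext => x /=; rewrite fineK// Radon_Nikodym_fin_num.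
have mY : measurable_wrt G Y by apply/measurable_EFinP; rewrite YE;
  exact: measurable_int iY.
exists Y => //.
suff : P.-integrable setT (EFin \o Y) /\ forall A, <<s G >> A ->
    (\int[P]_(w in A) (Y w)%:E = \int[P]_(w in A) (f w)%:E)%E.
  move=> [iPY eY]; split.
    rewrite (_ : _ \o _ = (EFin \o f) \- (EFin \o Y))%E//.
    exact: integrableB.
  move=> A GA; have mA := subalgebra_measurable GT GA.
  under eq_integral do rewrite /= EFinB.
  rewrite integralB//; [|exact: (integrableS measurableT mA (@subsetT _ _) fi)|
    exact: (integrableS measurableT mA (@subsetT _ _) iPY)].
  rewrite eY// subee//; apply: integrable_fin_num => //.
  exact: (integrableS measurableT mA (@subsetT _ _) fi).
have iPY : P.-integrable setT (EFin \o Y).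
  apply/integrableP; split.
    by apply/measurable_EFinP; exact: measurable_wrt_measurable mY.
  move/integrableP : iY => [mRN]; rewrite -YE => iY.
  rewrite -[X in (X < _)%E](@ge0_integral_pushforward _ _ _ _ _ _ mi P setT (fun x =>
    `|(EFin \o Y) x|)%E)//.
  apply: measurableT_comp => //. exact/measurable_EFinP.
split=> // A GA.
have -> : (\int[P]_(w in A) (f w)%:E)%E = nu A by [].
rewrite (Radon_Nikodym_integral numu)// -YE.
rewrite (@integral_pushforward _ _ _ _ _ _ mi P A)//.
exact/measurable_EFinP.
exact: (integrableS measurableT (subalgebra_measurable GT GA) (@subsetT _ _) iPY).
Qed.
End SubSigmaAlgebra.

(** * Integrals of a centered variable against multipliers known from the past *)

Section PullOut.
Import HBSimple HBNNSimple.
Context (disp : measure_display) (T : measurableType disp) (R : realType).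
Variable P : probability T R.
Implicit Types (G : set (set T)) (f g D : T -> R).

Lemma integrable_bounded_mul f D K : P.-integrable setT (EFin \o D) ->
  measurable_fun setT f -> (forall x, `|f x| <= K) ->
  P.-integrable setT (EFin \o (fun w => f w * D w)).
Proof.
move=> iD mf fK.
have mD : measurable_fun setT D by apply/measurable_EFinP; exact: measurable_int iD.
apply: (@le_integrable _ _ _ P _ measurableT _ (fun w => K%:E * (EFin \o D) w)%E).
- exact/measurable_EFinP/measurable_funM.
- move=> x _ /=; rewrite lee_fin !normrM ler_wpM2r//.
  by rewrite (le_trans (fK x))// ler_norm.
- exact: integrableZl.
Qed.

Lemma integral_indic_mul D (A : set T) (r : R) : measurable A ->
  P.-integrable setT (EFin \o D) ->
  (\int[P]_w (r * \1_A w * D w)%:E = r%:E * \int[P]_(w in A) (D w)%:E)%E.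
Proof.
move=> mA iD; rewrite [in RHS]integral_mkcond epatch_indic.
have iDA : P.-integrable setT ((EFin \o D) \* (EFin \o \1_A))%E.
  rewrite -epatch_indic; apply/(integrable_mkcond _ mA).
  exact: (integrableS measurableT mA (@subsetT _ _) iD).
rewrite -integralZl//; apply: eq_integral => x _ /=.
by rewrite -!EFinM; congr EFin; ring.
Qed.

Lemma cond_centered_nnsfun G D (g : {nnsfun (g_sigma_algebraType G) >-> R}) :
  G `<=` measurable -> cond_centered P G D -> (\int[P]_w ((g w * D w)%:E) = 0)%E.
Proof.
move=> GT [iD oD].
have mg y : <<s G >> (g @^-1` [set y]).
  exact: (@measurable_funPTI _ _ _ _ g).
have -> : (fun w => (g w * D w)%:E) = (fun w : T =>
    \sum_(y <- fset_set (range g)) (y * \1_(g @^-1` [set y]) w * D w)%:E)%E.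
  apply/funext => w; rewrite sumEFin -mulr_suml; congr (_ * _)%:E.
  rewrite fimfunE fsbig_finite//; exact: fimfunP.
rewrite integral_sum//.
  rewrite big1// => y _; rewrite integral_indic_mul//.
    by rewrite oD// mule0.
  exact: (subalgebra_measurable GT).
move=> y; apply: (@integrable_bounded_mul _ _ `|y|) => //.
  apply: measurable_funM => //; apply: measurable_indic.
  exact: (subalgebra_measurable GT).
move=> x; rewrite normrM ler_piMr// indicE; case: (_ \in _); rewrite ?normr1 ?normr0//.
Qed.

(** The approximating simple functions live on the measurable space of [<<s G >>], so each of them
    integrates to 0 against [D]; [K * |D|] dominates the sequence. *)
Lemma cond_centered_bounded_nonneg G D (h : T -> R) (K : R) : G `<=` measurable ->
  cond_centered P G D ->
  measurable_wrt G h -> (forall x, 0 <= h x <= K) ->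
  (\int[P]_w ((h w * D w)%:E) = 0)%E.
Proof.
move=> GT oD mh hK.
have [iD _] := oD.
have mD : measurable_fun setT D by apply/measurable_EFinP; exact: measurable_int iD.
have mh' : measurable_fun [set: g_sigma_algebraType G] (EFin \o h).
  exact/measurable_EFinP.
pose a := nnsfun_approx (@measurableT _ (g_sigma_algebraType G)) mh'.
have ma n : measurable_fun setT (a n : T -> R).
  by apply: (measurable_wrt_measurable GT); exact: measurable_funP.
have ha0 x : [set: g_sigma_algebraType G] x -> (0 <= (EFin \o h) x)%E.
  by move=> _; rewrite lee_fin; case/andP : (hK x).
have [|||||_ _] := @dominated_convergence _ _ _ P _ measurableT
  (fun n w => (a n w * D w)%:E) (fun w => (h w * D w)%:E)
  (fun w => (K%:E * `|(EFin \o D) w|)%E).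
- by move=> n; apply/measurable_EFinP/measurable_funM.
- by apply/measurable_EFinP/measurable_funM => //; exact: measurable_wrt_measurable mh.
- apply: nearW => x _.
  have : (EFin \o a ^~ x) n @[n --> \oo] --> (h x)%:E by exact: cvg_nnsfun_approx.
  move=> /fine_cvgP[_ /=] ah.
  apply: cvg_EFin; first exact: nearW.
  by apply: cvgMl; exact: ah.
- by apply: integrableZl => //; exact: integrable_abse.
- apply: nearW => x n _; rewrite abse_EFin -EFinM lee_fin normrM ler_wpM2r//.
  rewrite ger0_norm//.
  have : ((a n x)%:E <= (EFin \o h) x)%E.
    by rewrite /a nnsfun_approxE; exact: le_approx.
  by rewrite lee_fin => /le_trans; apply; case/andP : (hK x).
- rewrite (_ : [sequence _]_n = cst 0%E).
    by move=> h0; apply/esym; apply: (@cvg_unique _ _ _ _ _ _ _ h0) => //; exact: cvg_cst.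
  by apply/funext => n /=; rewrite (cond_centered_nnsfun (a n) GT oD).
Qed.

Lemma cond_centered_bounded G D (h : T -> R) (K : R) : G `<=` measurable ->
  cond_centered P G D ->
  measurable_wrt G h -> (forall x, `|h x| <= K) ->
  (\int[P]_w ((h w * D w)%:E) = 0)%E.
Proof.
move=> GT oD mh hK; have [iD D0] := oD.
have mh' := measurable_wrt_measurable GT mh.
have K0 : 0 <= K by exact: le_trans (hK point).
(* The shift by [K] makes the multiplier nonnegative, and the added constant integrates to 0 against
   [D] since [setT] belongs to [<<s G >>]. *)
have : (\int[P]_w (((h w + K) * D w)%:E) = 0)%E.
  apply: (@cond_centered_bounded_nonneg G D (fun w => h w + K) (K + K)) => //.
    exact: measurable_funD.
  by move=> x; have := hK x; rewrite ler_norml; lra.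
under eq_integral do rewrite mulrDl EFinD.
rewrite integralD//; last 2 first.
- exact: integrable_bounded_mul hK.
- exact: (integrable_bounded_mul (f := cst K) (K := `|K|)).
under [X in (_ + X)%E]eq_integral do rewrite EFinM.
rewrite integralZl// D0 ?mule0 ?adde0//.
exact: (@measurableT _ (g_sigma_algebraType G)).
Qed.

Lemma cond_centered_ae_bounded G D (h : T -> R) (K : R) : G `<=` measurable ->
  cond_centered P G D ->
  measurable_wrt G h -> (\forall x \ae P, `|h x| <= K) ->
  (\int[P]_w ((h w * D w)%:E) = 0)%E.
Proof.
move=> GT oD mh hK; have [iD D0] := oD.
have mD : measurable_fun setT D by apply/measurable_EFinP; exact: measurable_int iD.
(* Clipping alters [h] on a null set only and keeps it measurable for [<<s G >>]. *)
pose h' (w : T) : R := Num.max (- `|K|) (Num.min (h w) `|K|).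
have mh' : measurable_wrt G h'.
  by apply: measurable_maxr => //; exact: measurable_minr.
rewrite -(@cond_centered_bounded G D h' `|K|)//.
  apply: ae_eq_integral => //.
  - by apply/measurable_EFinP/measurable_funM => //; exact: measurable_wrt_measurable mh.
  - by apply/measurable_EFinP/measurable_funM => //; exact: measurable_wrt_measurable mh'.
  - apply: filterS hK => x hx _; rewrite /h'; congr (_ * _)%:E.
    have := le_trans hx (ler_norm K); rewrite ler_norml => /andP[h1 h2].
    by rewrite min_l// max_r.
move=> x; rewrite ler_norml /h' le_max lexx/= ge_max ge_min lexx orbT andbT.
by have := normr_ge0 K; lra.
Qed.

Lemma integrable_ae_bounded_mul D (h : T -> R) (K : R) : P.-integrable setT (EFin \o D) ->
  measurable_fun setT h -> (\forall x \ae P, `|h x| <= K) ->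
  P.-integrable setT (EFin \o (fun w => h w * D w)).
Proof.
move=> iD mh hK.
have mD : measurable_fun setT D by apply/measurable_EFinP; exact: measurable_int iD.
pose h' (w : T) : R := Num.max (- `|K|) (Num.min (h w) `|K|).
have mh' : measurable_fun setT h'.
  by apply: measurable_maxr => //; exact: measurable_minr.
have /integrableP[mi fi] : P.-integrable setT (EFin \o (fun w => h' w * D w)).
  apply: (@integrable_bounded_mul _ _ `|K|) => // x.
  rewrite ler_norml /h' le_max lexx/= ge_max ge_min lexx orbT andbT.
  by have := normr_ge0 K; lra.
apply/integrableP; split; first exact/measurable_EFinP/measurable_funM.
rewrite (_ : (\int[P]_x _ = \int[P]_x `|(EFin \o (fun w => (h' w * D w)%R)) x|)%E)//.
apply: ae_eq_integral => //.
- apply/measurableT_comp => //; exact/measurable_EFinP/measurable_funM.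
- by apply/measurableT_comp.
- apply: filterS hK => x hx _; rewrite /h' /=; congr (`| _ * _|)%:E.
  have := le_trans hx (ler_norm K); rewrite ler_norml => /andP[h1 h2].
  by rewrite min_l// max_r.
Qed.
End PullOut.

(* Young's inequality, as the tangent line of the p-th power at [z'], a truncation
   of [z] that keeps the test function bounded. *)
Lemma young_tangent (R : realType) (p z w z' : R) : 2 <= p ->
  z * z' >= z' ^+ 2 ->
  `|z'| `^ p + p * (z' * `|z'| `^ (p - 2) * (w - z)) <= `|w| `^ p.
Proof.
move=> p2 zz'.
have p0 : 0 < p by lra.
have p1 : 0 < p - 1 by lra.
set a := `|z'|.
have a0 : 0 <= a by exact: normr_ge0.
have E1 : z' ^+ 2 * a `^ (p - 2) = a `^ p.
  have [z00|z0] := eqVneq z' 0.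
    by rewrite /a z00 expr2 !mul0r normr0 powR0// gt_eqF.
  rewrite -(real_normK (num_real z')) -/a -powR_mulrn// -powRD.
    by congr (_ `^ _); lra.
  by rewrite /a normr_eq0 z0 implybT.
have E2 : `|z' * a `^ (p - 2)| = a `^ (p - 1).
  rewrite normrM -/a (ger0_norm (powR_ge0 _ _)).
  have [a00|z0] := eqVneq a 0; first by rewrite a00 mul0r powR0// gt_eqF.
  rewrite -[X in X * _]powRr1// -powRD ?z0 ?implybT//.
  by congr (_ `^ _); lra.
have Y : `|w| * a `^ (p - 1) <= `|w| `^ p / p + (a `^ (p - 1)) `^ (p / (p - 1)) / (p /
  (p - 1)).
  apply: conjugate_powR; rewrite ?powR_ge0 ?normr_ge0 ?divr_gt0//.
  by rewrite invf_div; field; lra.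
rewrite -powRrM in Y.
have e3 : (p - 1) * (p / (p - 1)) = p by field; lra.
rewrite e3 invf_div in Y.
have hw : z' * a `^ (p - 2) * w <= `|w| * a `^ (p - 1).
  by rewrite -E2 -normrM mulrC ler_norm.
have hz : a `^ p <= z' * a `^ (p - 2) * z.
  rewrite -E1 [leRHS](_ : _ = z * z' * a `^ (p - 2)); last by ring.
  by rewrite ler_wpM2r// powR_ge0.
have Y' : p * (`|w| * a `^ (p - 1)) <= `|w| `^ p + (p - 1) * a `^ p.
  rewrite [leRHS](_ : _ = p * (`|w| `^ p / p + a `^ p * ((p - 1) / p))); last by field;
    lra.
  by rewrite ler_pM2l.
have hw' := ler_wpM2l (ltW p0) hw.
have hz' := ler_wpM2l (ltW p0) hz.
lra.
Qed.

(** * Conditional expectation does not increase norms *)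

Section Contraction.
Context (disp : measure_display) (T : measurableType disp) (R : realType).
Variable P : probability T R.
Implicit Types (G : set (set T)) (f g D : T -> R).

Lemma measurable_norm_powR f (p : R) : measurable_fun setT f ->
  measurable_fun setT (fun x => (`|f x| `^ p)%:E).
Proof.
move=> mf; apply/measurable_EFinP.
apply: (@measurableT_comp _ _ _ _ _ _ (@powR R ^~ p)) => //.
exact: measurableT_comp.
Qed.

Definition clip (n : nat) (z : R) : R := Num.max (- n%:R) (Num.min z n%:R).

Lemma norm_clip n z : `|clip n z| = Num.min `|z| n%:R.
Proof.
rewrite /clip; have n0 : 0 <= n%:R :> R by [].
have [z0|z0] := leP 0 z.
  have h : 0 <= Num.min z n%:R by rewrite le_min z0 n0.
  by rewrite max_r ?(ger0_norm h) ?(ger0_norm z0)//; lra.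
rewrite min_l; last lra.
rewrite (ltr0_norm z0); have [h|h] := leP (- n%:R) z.
  by rewrite (ltr0_norm z0) min_l//; lra.
by rewrite normrN ger0_norm// min_r//; lra.
Qed.

Lemma clip_mul_ge n (z : R) : z * clip n z >= clip n z ^+ 2.
Proof.
rewrite /clip; have n0 : 0 <= n%:R :> R by [].
have [z0|z0] := leP 0 z.
  have h0 : 0 <= Num.min z n%:R by rewrite le_min z0 n0.
  rewrite max_r; last lra.
  by have [h|h] := leP z n%:R; nra.
rewrite min_l; last lra.
by have [h|h] := leP (- n%:R) z; nra.
Qed.

(** Conditional Jensen inequality. In [young_tangent] at the clipped value of [f], the linear term
    is a bounded [<<s G >>]-measurable multiple of [D] and integrates to 0; monotone convergence
    then lifts the clipping. *)
Lemma moment_contract G f D (p : R) : 2 <= p -> G `<=` measurable -> measurable_wrt G f ->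
  cond_centered P G D ->
  (\int[P]_x (`|f x| `^ p)%:E <= \int[P]_x (`|f x + D x| `^ p)%:E)%E.
Proof.
move=> p2 GT gf oD.
have [iD _] := oD.
have mD : measurable_fun setT D by apply/measurable_EFinP; exact: measurable_int iD.
have mf := measurable_wrt_measurable GT gf.
have mfD : measurable_fun setT (f \+ D) by exact: measurable_funD.
have [->|fin] := eqVneq (\int[P]_x (`|f x + D x| `^ p)%:E)%E +oo%E.
  exact: leey.
have p0 : 0 < p by lra.
have iW : P.-integrable setT (fun x => (`|f x + D x| `^ p)%:E).
  apply/integrableP; split; first exact: (@measurable_norm_powR (f \+ D)).
  under eq_integral do rewrite gee0_abs ?lee_fin ?powR_ge0//.
  by rewrite ltey.
pose a n x := (`|clip n (f x)| `^ p)%:E.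
have gc n : measurable_wrt G (fun x => clip n (f x)).
  by apply: measurable_maxr => //; exact: measurable_minr.
have mc n : measurable_fun setT (fun x =>
  clip n (f x)) by exact: measurable_wrt_measurable (gc n).
have ma n : measurable_fun setT (a n) by exact: measurable_norm_powR.
have a0 n x : (0 <= a n x)%E by rewrite lee_fin powR_ge0.
have and_ x : {homo a ^~ x : n m / (n <= m)%N >-> (n <= m)%E}.
  have p0' := ltW p0.
  move=> n m nm; rewrite lee_fin ge0_ler_powR ?nnegrE//.
  rewrite !norm_clip le_min ge_min lexx/= ge_min.
  by rewrite ler_nat nm orbT.
have cv := @cvg_monotone_convergence _ _ _ P _ measurableT a ma (fun n x _ =>
  a0 n x) (fun x _ => and_ x).
have <- : (\int[P]_x limn (a ^~ x) = \int[P]_x (`|f x| `^ p)%:E)%E.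
  apply: eq_integral => x _; apply: lim_near_cst => //.
  exists (Num.truncn `|f x|).+1 => //= n /= hn.
  rewrite /a norm_clip min_l//.
  have := truncnS_gt `|f x|; move=> /ltW /le_trans; apply.
  by rewrite ler_nat.
rewrite -(cvg_lim _ cv)//; apply: lime_le; first by apply/cvg_ex; eexists; exact: cv.
apply: nearW => n.
pose h x := clip n (f x) * `|clip n (f x)| `^ (p - 2).
have gh : measurable_wrt G h.
  apply: measurable_funM; first exact: gc.
  apply: (@measurableT_comp _ _ _ _ _ _ (@powR R ^~ (p - 2))) => //.
  by apply: measurableT_comp => //; exact: gc.
have hK x : `|h x| <= n%:R * n%:R `^ (p - 2).
  have hc : `|clip n (f x)| <= n%:R by rewrite norm_clip ge_min lexx orbT.
  rewrite /h normrM; apply: ler_pM => //.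
  by rewrite ger0_norm ?powR_ge0// ge0_ler_powR ?nnegrE//; lra.
have ihD := integrable_bounded_mul iD (measurable_wrt_measurable GT gh) hK.
have ia : P.-integrable setT (a n).
  apply: (@measurable_bounded_integrable _ T R P (fun x =>
    `|clip n (f x)| `^ p) setT measurableT).
  - by apply: (le_lt_trans (probability_le1 P measurableT)); rewrite ltry.
  - by apply/measurable_EFinP; exact: (ma n).
  - exists (n%:R `^ p); split=> // y ny x _ /=.
    rewrite (le_trans _ (ltW ny))// ger0_norm ?powR_ge0// ge0_ler_powR ?nnegrE//;
      first lra.
    by rewrite norm_clip ge_min lexx orbT.
have -> : (\int[P]_x a n x = \int[P]_x (a n x + p%:E * (h x * D x)%:E))%E.
  rewrite integralD//; last exact: integrableZl.
  by rewrite integralZl// (cond_centered_bounded GT oD gh hK) mule0 adde0.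
apply: le_integral => //.
  by apply: integrableD => //; exact: integrableZl.
move=> x _; rewrite lee_fin.
have := @young_tangent R p (f x) (f x + D x) (clip n (f x)) p2 (clip_mul_ge n (f x)).
by rewrite [f x + D x - f x]addrAC subrr add0r.
Qed.

(** On the event [A] that f > c, almost surely D < 0, whereas [D] integrates to 0 over [A]. So [D]
    vanishes almost everywhere on [A], and [A] must be null. *)
Lemma ae_bound_contract1 G f D (c : R) : G `<=` measurable -> measurable_wrt G f ->
  cond_centered P G D -> (\forall x \ae P, f x + D x <= c) -> (\forall x \ae P, f x <= c).
Proof.
move=> GT gf [iD oD] hc.
pose A := f @^-1` `]c, +oo[.
have GA : <<s G >> A by exact: measurable_wrt_preimage.
have mA := subalgebra_measurable GT GA.
have mD : measurable_fun setT D by apply/measurable_EFinP; exact: measurable_int iD.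
have : (\int[P]_(x in A) `|(EFin \o D) x| = 0)%E.
  rewrite (ae_eq_integral (fun x => - (D x)%:E)%E)//.
  - rewrite integralN ?oD ?oppe0//.
    apply: integrable_add_def => //.
    exact: (integrableS measurableT mA (@subsetT _ _) iD).
  - apply: measurableT_comp => //; apply: measurable_funTS; exact/measurable_EFinP.
  - apply/measurable_EFinP; apply: measurableT_comp => //; exact: measurable_funTS.
  - apply: filterS hc => x hx; rewrite /A /= in_itv/= andbT => cx.
    by rewrite ltr0_norm//; lra.
move=> /ae_eq_integral_abs; case=> //.
  apply: measurable_funTS; exact/measurable_EFinP.
move=> N [mN N0 hN].
case: hc => M [mM M0 hM]; exists (N `|` M); split.
- exact: measurableU.
- by rewrite measureU0.
move=> x /= /negP; rewrite -ltNge => cx.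
have [Mx|Mx] := pselect (M x); [by right|left].
apply: hN => /= h.
have := h; rewrite /A /= in_itv/= andbT => /(_ cx) [] Dx.
apply: Mx; apply: hM => /=; rewrite Dx addr0.
by apply/negP; rewrite -ltNge.
Qed.

Lemma ae_bound_contract G f D (c : R) : G `<=` measurable -> measurable_wrt G f ->
  cond_centered P G D -> (\forall x \ae P, `|f x + D x| <= c) -> (\forall x \ae P,
    `|f x| <= c).
Proof.
move=> GT gf oD hc.
have h1 : \forall x \ae P, f x <= c.
  apply: (ae_bound_contract1 GT gf oD).
  by apply: filterS hc => x; rewrite ler_norml; lra.
have h2 : \forall x \ae P, - f x <= c.
  apply: (@ae_bound_contract1 G (\- f) (\- D)) => //.
  - exact: measurableT_comp.
  - exact: cond_centeredN.
  apply: filterS hc => x; rewrite ler_norml /=; lra.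
by apply: filterS2 h1 h2 => x; rewrite ler_norml; lra.
Qed.

Lemma Lnorm_contract G f D (p : \bar R) : (2%:E <= p)%E -> G `<=` measurable ->
  measurable_wrt G f -> cond_centered P G D ->
  ('N[P]_p[EFin \o f] <= 'N[P]_p[EFin \o (f \+ D)%R])%E.
Proof.
case: p => [p||] p2 GT gf oD; last by rewrite leeNy_eq in p2.
  rewrite lee_fin in p2.
  rewrite unlock gt0_ler_poweR ?invr_ge0 ?in_itv/= ?leey ?andbT//.
  - by lra.
  - by apply: integral_ge0 => x _; rewrite lee_fin powR_ge0.
  - by apply: integral_ge0 => x _; rewrite lee_fin powR_ge0.
  exact: (moment_contract p2 GT gf oD).
have P0 : (0 < P [set: T])%E by have := @probability_setT _ _ _ P; rewrite /= => ->.
rewrite unlock !ifT//.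
have [->|] := eqVneq (ess_sup P (abse \o (EFin \o (f \+ D)))) +oo%E.
  exact: leey.
have := ess_sup_ge P (abse \o (EFin \o (f \+ D))).
case: ess_sup => [c hc _||] //.
  apply/ess_supP.
  exact: (ae_bound_contract GT gf oD).
(* An essential supremum equal to -oo would make almost every point contradictory, which a
   probability forbids. *)
move=> h _.
have : \forall x \ae P, False.
  by apply: filterS h => x; rewrite leeNy_eq.
case=> N [mN N0 hN].
have : P setT = 0%E by rewrite (subset_measure0 _ mN)// => x _; exact: hN.
by move: P0 => /[swap] ->; rewrite ltxx.
Qed.
End Contraction.

(** * Martingale inequalities *)

Section Smoothness.
Context (disp : measure_display) (T : measurableType disp) (R : realType).
Variable P : probability T R.
Implicit Types (G : set (set T)) (f g D S : T -> R).

Lemma moment_LnormE (p r : R) f : 0 < p -> ('N[P]_p%:E[EFin \o f] = r%:E)%E ->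
  (\int[P]_x (`|f x| `^ p)%:E = (r `^ p)%:E)%E.
Proof.
by move=> p0 E; rewrite -poweR_EFin -E poweR_Lnorm// gt_eqF.
Qed.

Lemma Lnorm_momentE (p r : R) f : 0 < p -> 0 <= r ->
  (\int[P]_x (`|f x| `^ p)%:E = (r `^ p)%:E)%E -> ('N[P]_p%:E[EFin \o f] = r%:E)%E.
Proof.
move=> p0 r0 E; rewrite unlock /= E poweR_EFin -powRrM divff ?gt_eqF//.
by rewrite powRr1.
Qed.

Lemma Lnorm_scale_sqr (p k r : R) f : 0 < p -> 0 <= k -> 0 <= r ->
  measurable_fun setT f ->
  ('N[P]_p%:E[EFin \o f] = r%:E)%E ->
  ('N[P]_(p / 2)%:E[EFin \o (fun x => k * f x ^+ 2)%R] = (k * r ^+ 2)%:E)%E.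
Proof.
move=> p0 k0 r0 mf E.
apply: Lnorm_momentE; rewrite ?divr_gt0 ?mulr_ge0 ?sqr_ge0//.
have sqE a : `|k * a ^+ 2| `^ (p / 2) = k `^ (p / 2) * `|a| `^ p.
  rewrite normrM normrX (ger0_norm k0) powRM ?exprn_ge0//.
  congr (_ * _); rewrite -powR_mulrn// -powRrM; congr (_ `^ _); by field.
under eq_integral do rewrite sqE EFinM.
rewrite ge0_integralZl_EFin ?powR_ge0//.
- rewrite (moment_LnormE p0 E) -EFinM; congr EFin.
  by have := sqE r; rewrite (ger0_norm r0) ger0_norm ?mulr_ge0 ?sqr_ge0.
- exact: measurable_norm_powR.
Qed.

Lemma Lnorm_fin (p c : R) f : ('N[P]_p%:E[EFin \o f] <= c%:E)%E ->
  exists r, [/\ 0 <= r, r <= c & ('N[P]_p%:E[EFin \o f] = r%:E)%E].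
Proof.
move=> Nc; have N0 := Lnorm_ge0 P p%:E (EFin \o f).
have fin : 'N[P]_p%:E[EFin \o f]%E \is a fin_num.
  by rewrite ge0_fin_numE// (le_lt_trans Nc)// ltry.
exists (fine 'N[P]_p%:E[EFin \o f]%E); split; last by rewrite fineK.
- exact: fine_ge0.
- by rewrite -lee_fin fineK.
Qed.

(* The two-point inequality bounds [S + D] and [S - D] together; the norm of
   [S - D] is at least that of [S], its conditional expectation. *)
Lemma Lnorm_martingale_step G S D (p s c : R) : 2 <= p -> G `<=` measurable ->
  measurable_wrt G S -> cond_centered P G D -> ('N[P]_p%:E[EFin \o S] <= s%:E)%E ->
  ('N[P]_p%:E[EFin \o D] <= c%:E)%E ->
  ('N[P]_p%:E[EFin \o (S \+ D)%R] <= (Num.sqrt (s ^+ 2 + 4 * p * c ^+ 2))%:E)%E.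
Proof.
move=> p2 GT gS oD.
have p0 : 0 < p by lra.
have p1 : 1 <= p by lra.
have [iD _] := oD.
have mD : measurable_fun setT D by apply/measurable_EFinP; exact: measurable_int iD.
have mS := measurable_wrt_measurable GT gS.
move=> /Lnorm_fin[r [r0 rs Er]] /Lnorm_fin[d [d0 dc Ed]].
have mND : measurable_fun setT (\- D) by exact: measurableT_comp.
have END : ('N[P]_p%:E[EFin \o (\- D)%R] = d%:E)%E.
  by rewrite -Ed -[RHS]oppe_Lnorm.
have /Lnorm_fin[a [a0 _ Ea]] : ('N[P]_p%:E[EFin \o (S \+ D)%R] <= (r + d)%:E)%E.
  by rewrite EFinD -Er -Ed minkowski_EFin.
have /Lnorm_fin[b [b0 _ Eb]] : ('N[P]_p%:E[EFin \o (S \+ \- D)%R] <= (r + d)%:E)%E.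
  by rewrite EFinD -Er -END minkowski_EFin.
have rb : r <= b.
  rewrite -lee_fin -Er -Eb; apply: (Lnorm_contract _ GT gS (cond_centeredN GT oD)).
  by rewrite lee_fin.
have mSD : measurable_fun setT (S \+ D) by exact: measurable_funD.
have mSND : measurable_fun setT (S \+ \- D) by exact: measurable_funD.
pose h x := S x ^+ 2 + 2 * p * D x ^+ 2.
have p20 : 0 < p / 2 by lra.
have h0 x : 0 <= h x by rewrite addr_ge0 ?sqr_ge0// mulr_ge0 ?sqr_ge0//; lra.
have mh1 : measurable_fun setT (fun x => 1 * S x ^+ 2).
  by apply: measurable_funM => //; exact: measurable_funX.
have mh2 : measurable_fun setT (fun x => 2 * p * D x ^+ 2).
  by apply: measurable_funM => //; exact: measurable_funX.
have mh : measurable_fun setT h.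
  by apply: measurable_funD => //; exact: measurable_funX.
(* Triangle inequality in L^(p/2), available because p/2 >= 1. *)
have : ('N[P]_(p / 2)%:E[EFin \o h] <= (r ^+ 2 + 2 * p * d ^+ 2)%:E)%E.
  rewrite (_ : h = (fun x => 1 * S x ^+ 2) \+ (fun x => 2 * p * D x ^+ 2)); last first.
    by apply/funext => x; rewrite /h /= mul1r.
  apply: (le_trans (minkowski_EFin _ mh1 mh2 _)); first lra.
  rewrite (Lnorm_scale_sqr _ _ r0 mS Er)// (Lnorm_scale_sqr _ _ d0 mD Ed)//; last lra.
  by rewrite -EFinD mul1r.
move=> /Lnorm_fin[e [e0 ec Ee]].
have H : a `^ p + b `^ p <= 2 * e `^ (p / 2).
  rewrite -lee_fin EFinD EFinM -(moment_LnormE p0 Ea) -(moment_LnormE p0 Eb).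
  rewrite -(moment_LnormE p20 Ee) -ge0_integralD//; last 2 first.
  - exact: measurable_norm_powR.
  - exact: measurable_norm_powR.
  rewrite -ge0_integralZl_EFin//; last first.
    exact: measurable_norm_powR.
  apply: ge0_le_integral => //.
  - by move=> x _; rewrite adde_ge0// lee_fin powR_ge0.
  - by apply: emeasurable_funD; exact: measurable_norm_powR.
  - by apply: emeasurable_funM => //; exact: measurable_norm_powR.
  move=> x _; rewrite -EFinD -EFinM lee_fin (ger0_norm (h0 x)).
  exact: two_point.
(* Convexity of the power p/2 passes from the mean of the p-th powers to the mean of the squares. *)
have : ((a ^+ 2 + b ^+ 2) / 2) `^ (p / 2) <= e `^ (p / 2).
  have half : 0 <= (1 / 2 : R) <= 1 by lra.
  have hp : 1 <= p / 2 by lra.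
  have nn (z : R) : z ^+ 2 \in (`[0, +oo[%classic : set R).
    by rewrite inE/= in_itv/= andbT sqr_ge0.
  have := convex_powR hp (Itv01 (proj1 (andP half)) (proj2 (andP half))) (nn a) (nn b).
  rewrite convRE [X in X `^ _ <= _ -> _]convRE /= /unstable.onem.
  have sqE z : 0 <= z -> (z ^+ 2) `^ (p / 2) = z `^ p.
    by move=> z0; rewrite -powR_mulrn// -powRrM; congr (_ `^ _); field.
  rewrite !sqE// (_ : 1 / 2 * a ^+ 2 + (1 - 1 / 2) * b ^+ 2 = (a ^+ 2 + b ^+ 2) / 2).
    by lra.
  by field.
move=> H2.
have H3 : (a ^+ 2 + b ^+ 2) / 2 <= e.
  rewrite leNgt; apply/negP => /(gt0_ltr_powR p20); rewrite !nnegrE => /(_ e0).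
  rewrite divr_ge0 ?addr_ge0 ?sqr_ge0// => /(_ isT).
  by rewrite ltNge H2.
(* With r <= b: a^2 <= 2 e - b^2 <= 2 (r^2 + 2 p d^2) - r^2 = r^2 + 4 p d^2. *)
rewrite Ea lee_fin -[leLHS](ger0_norm a0) -sqrtr_sqr ler_wsqrtr//.
have := ler_pM r0 r0 rb rb; have := ler_pM r0 r0 rs rs; have := ler_pM d0 d0 dc dc.
move=> dd rr bb.
have := ler_wpM2l (ltW p0) dd.
rewrite !expr2 in ec H3 *; lra.
Qed.

Lemma Lnorm_martingale (n : nat) (G : nat -> set (set T)) (D : nat -> T -> R)
    (c : nat -> R) (p : R) : 2 <= p ->
  (forall j, G j `<=` measurable) -> (forall j, G j `<=` G j.+1) ->
  (forall j, (j < n)%N -> measurable_wrt (G j.+1) (D j)) ->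
  (forall j, (j < n)%N -> cond_centered P (G j) (D j)) ->
  (forall j, (j < n)%N -> ('N[P]_p%:E[EFin \o D j] <= (c j)%:E)%E) ->
  measurable_wrt (G n) (fun w => \sum_(j < n) D j w) /\
  ('N[P]_p%:E[EFin \o (fun w => \sum_(j < n) D j w)%R]
    <= (2 * Num.sqrt p * Num.sqrt (\sum_(j < n) c j ^+ 2))%:E)%E.
Proof.
move=> p2 GT GS; elim: n => [|n IH] gD oD cD.
  split.
    rewrite (_ : (fun _ => _) = cst 0); first exact: measurable_cst.
    by apply/funext => w; rewrite big_ord0.
  rewrite (_ : _ \o _ = cst 0%E).
    by rewrite Lnorm0 ?eqe ?gt_eqF ?big_ord0 ?sqrtr0 ?mulr0//; lra.
  by apply/funext => w; rewrite /= big_ord0.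
have [|||g1 N1] := IH.
- by move=> j jn; apply: gD; exact: ltnW.
- by move=> j jn; apply: oD; exact: ltnW.
- by move=> j jn; apply: cD; exact: ltnW.
have E : (fun w => \sum_(j < n.+1) D j w) = (fun w => \sum_(j < n) D j w) \+ D n.
  by apply/funext => w; rewrite big_ord_recr.
split.
  rewrite E; apply: measurable_funD; last exact: gD.
  apply: measurable_wrtW g1; exact: (subset_trans (GS n) (@sub_sigma_algebra _ _ _)).
rewrite E.
have := Lnorm_martingale_step p2 (GT n) g1 (oD n (ltnSn n)) N1 (cD n (ltnSn n)).
move=> /le_trans; apply; rewrite lee_fin.
have p0 : 0 <= p by lra.
have s0 : 0 <= \sum_(j < n) c j ^+ 2 by apply: sumr_ge0 => j _; exact: sqr_ge0.
rewrite big_ord_recr/= !exprMn !sqr_sqrtr//.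
rewrite (_ : 2 ^+ 2 * p * _ + _ = 2 ^+ 2 * (p * (\sum_(i < n) c i ^+ 2 + c n ^+ 2)));
  last by ring.
by rewrite sqrtrM ?exprn_ge0// sqrtr_sqr ger0_norm// sqrtrM// mulrA.
Qed.
End Smoothness.

(** * Exponential moments of martingales *)

Section SubGaussian.
Context (disp : measure_display) (T : measurableType disp) (R : realType).
Variable P : probability T R.
Implicit Types (G : set (set T)) (f g D S : T -> R).

(** Hoeffding's lemma before integration: over [-c, c] the chord of exp(l y) has height cosh(l c) at
    0, and its linear part will integrate to 0 against the past. For c <= 0 only y = 0 can occur. *)
Lemma expR_chord (l c : R) : exists B : R, forall y, `|y| <= c ->
  expR (l * y) <= expR (l ^+ 2 * c ^+ 2 / 2) + B * y.
Proof.
have [c0|c0] := leP c 0.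
  exists 0 => y yc.
  have y0 : y = 0 by apply/eqP; rewrite -normr_le0 (le_trans yc).
  rewrite y0 !mulr0 addr0 expR0 -[leLHS]expR0 ler_expR.
  by rewrite mulr_ge0// mulr_ge0 ?sqr_ge0.
exists ((expR (l * c) - expR (- (l * c))) / (2 * c)) => y;
  rewrite ler_norml => /andP[y1 y2].
pose t := (1 + y / c) / 2.
have yE : y = (2 * t - 1) * c by rewrite /t; field; lra.
have t01 : 0 <= t <= 1 by apply/andP; split; nra.
have := @convex_expR R (Itv01 (proj1 (andP t01)) (proj2 (andP t01))) (l * c) (- (l * c)).
rewrite !convRE/= /unstable.onem (_ : t * (l * c) + _ = l * y); last by rewrite yE; ring.
move=> /le_trans; apply.
have := cosh_le_expR (l * c); rewrite exprMn => h.
have -> : (expR (l * c) - expR (- (l * c))) / (2 * c) * y =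
    (t - 1 / 2) * (expR (l * c) - expR (- (l * c))).
  by rewrite /t; field; lra.
lra.
Qed.

Lemma measurable_mgf f (l : R) : measurable_fun setT f ->
  measurable_fun setT (fun x => (expR (l * f x))%:E).
Proof.
move=> mf; apply/measurable_EFinP; apply: measurableT_comp => //.
exact: measurable_funM.
Qed.

(** Multiplying the chord bound by exp(l S), which is almost surely bounded and known from the past,
    removes the term linear in [D]. *)
Lemma mgf_martingale_step G S D (K c v l : R) : G `<=` measurable ->
  measurable_wrt G S -> cond_centered P G D -> (\forall x \ae P, `|S x| <= K) ->
  (\forall x \ae P, `|D x| <= c) ->
  (\int[P]_x (expR (l * S x))%:E <= (expR (l ^+ 2 * v / 2))%:E)%E ->
  (\int[P]_x (expR (l * (S x + D x)))%:E <= (expR (l ^+ 2 * (v + c ^+ 2) / 2))%:E)%E.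
Proof.
move=> GT gS oD SK Dc Sv.
have [iD _] := oD.
have mD : measurable_fun setT D by apply/measurable_EFinP; exact: measurable_int iD.
have mS := measurable_wrt_measurable GT gS.
have [B HB] := expR_chord l c.
set A := expR _ in HB.
pose h x := expR (l * S x).
have gh : measurable_wrt G h.
  by apply: measurableT_comp => //; exact: measurable_funM.
have hK : \forall x \ae P, `|h x| <= expR (`|l| * K).
  apply: filterS SK => x Sx; rewrite ger0_norm ?expR_ge0// ler_expR.
  by rewrite (le_trans (ler_norm _))// normrM ler_wpM2l.
have mh := measurable_wrt_measurable GT gh.
have i1 : P.-integrable setT (EFin \o h).
  have i1 : P.-integrable setT (EFin \o (fun x => h x * cst 1 x)).
    apply: (integrable_ae_bounded_mul _ mh hK).
    exact: finite_measure_integrable_cst.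
  by rewrite (_ : h = (fun x => h x * cst 1 x)); last by apply/funext => x /=;
    rewrite mulr1.
have i2 := integrable_ae_bounded_mul iD mh hK.
have I2 := cond_centered_ae_bounded GT oD gh hK.
pose r x := (A * h x + B * (h x * D x)).
have mr : measurable_fun setT r.
  by apply: measurable_funD; apply: measurable_funM => //; exact: measurable_funM.
have Ir : (\int[P]_x (r x)%:E = A%:E * \int[P]_x (h x)%:E)%E.
  have j1 := integrableZl measurableT A i1.
  have j2 := integrableZl measurableT B i2.
  rewrite -[RHS]adde0 -[X in (_ + X)%E](mule0 B%:E) -I2.
  rewrite -(integralZl measurableT i1) -(integralZl measurableT i2).
  by rewrite -(integralD measurableT j1 j2).
(* The bound by [r] holds only almost everywhere; the maximum with the left-hand side makes it hold
   everywhere without changing the integral of [r]. *)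
have le1 : (\int[P]_x (expR (l * (S x + D x)))%:E <= \int[P]_x (r x)%:E)%E.
  rewrite (@ae_eq_integral _ _ _ P setT (fun x =>
    (Num.max (expR (l * (S x + D x))) (r x))%:E) (fun x => (r x)%:E))//.
  - apply: ge0_le_integral => //.
    + by apply: (@measurable_mgf (S \+ D)); exact: measurable_funD.
    + apply/measurable_EFinP; apply: measurable_maxr => //.
      by apply/measurable_EFinP; apply: (@measurable_mgf (S \+ D));
        exact: measurable_funD.
    + by move=> x _; rewrite lee_fin le_max lexx.
  - exact/measurable_EFinP.
  - apply/measurable_EFinP; apply: measurable_maxr => //.
    by apply/measurable_EFinP; apply: (@measurable_mgf (S \+ D)); exact: measurable_funD.
  - apply: filterS Dc => x Dx _; congr EFin; apply/esym/max_r.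
    rewrite mulrDr expRD /r -/(h x).
    have := ler_wpM2l (expR_ge0 (l * S x)) (HB _ Dx); rewrite -/(h x); lra.
apply: (le_trans le1); rewrite Ir mulrDr mulrDl expRD EFinM muleC.
by rewrite lee_wpmul2r// lee_fin expR_ge0.
Qed.

(** The almost sure bound on the partial sums is proved along the way because it makes exp(l S) an
    admissible multiplier at the next step. *)
Lemma mgf_martingale (n : nat) (G : nat -> set (set T)) (D : nat -> T -> R)
    (c : nat -> R) :
  (forall j, G j `<=` measurable) -> (forall j, G j `<=` G j.+1) ->
  (forall j, (j < n)%N -> measurable_wrt (G j.+1) (D j)) ->
  (forall j, (j < n)%N -> cond_centered P (G j) (D j)) ->
  (forall j, (j < n)%N -> \forall x \ae P, `|D j x| <= c j) ->
  [/\ measurable_wrt (G n) (fun w => \sum_(j < n) D j w),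
    \forall x \ae P, `|\sum_(j < n) D j x| <= \sum_(j < n) c j &
  forall l, (\int[P]_x (expR (l * \sum_(j < n) D j x))%:E <=
    (expR (l ^+ 2 * (\sum_(j < n) c j ^+ 2) / 2))%:E)%E].
Proof.
move=> GT GS; elim: n => [|n IH] gD oD cD.
  split.
  - rewrite (_ : (fun _ => _) = cst 0); first exact: measurable_cst.
    by apply/funext => w; rewrite big_ord0.
  - by apply: nearW => x; rewrite !big_ord0 normr0.
  - move=> l; under eq_integral do rewrite big_ord0 mulr0 expR0.
    by rewrite integral_cst// mul1e big_ord0 mulr0 mul0r expR0; exact: probability_le1.
have [|||g1 b1 N1] := IH.
- by move=> j jn; apply: gD; exact: ltnW.
- by move=> j jn; apply: oD; exact: ltnW.
- by move=> j jn; apply: cD; exact: ltnW.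
split.
- rewrite (_ : (fun w => _) = (fun w => \sum_(j < n) D j w) \+ D n); last first.
    by apply/funext => w; rewrite big_ord_recr.
  apply: measurable_funD; last exact: gD.
  apply: measurable_wrtW g1; exact: (subset_trans (GS n) (@sub_sigma_algebra _ _ _)).
- apply: filterS2 b1 (cD n (ltnSn n)) => x h1 h2.
  by rewrite !big_ord_recr/= (le_trans (ler_normD _ _))// lerD.
- move=> l; under eq_integral do rewrite big_ord_recr/=.
  rewrite [X in expR (_ * X / _)]big_ord_recr/=.
  exact: (mgf_martingale_step (GT n) g1 (oD n (ltnSn n)) b1 (cD n (ltnSn n)) (N1 l)).
Qed.

(* The strict inequality makes this the assertion that the infimum in
   [subgaussian_norm] is at most [c]. *)
Definition sub_gaussian f (c : R) := [/\ measurable_fun setT f, 0 <= c &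
  forall c', c < c' -> forall l,
    (\int[P]_x (expR (l * f x))%:E <= (expR (l ^+ 2 * c' ^+ 2 / 2))%:E)%E].

(* By convexity of [expR] with weights proportional to the two bounds. *)
Lemma sub_gaussianD f g (a b : R) : sub_gaussian f a -> sub_gaussian g b ->
  sub_gaussian (f \+ g) (a + b).
Proof.
move=> [mf a0 fa] [mg b0 gb]; split; [exact: measurable_funD|exact: addr_ge0|].
move=> c' abc l.
(* Sharing the slack between the two bounds keeps both weights positive even if [a] or [b] is 0. *)
pose e := (c' - (a + b)) / 2.
have e0 : 0 < e by rewrite /e; lra.
have c'E : c' = (a + e) + (b + e) by rewrite /e; lra.
have a'0 : 0 < a + e by lra.
have b'0 : 0 < b + e by lra.
have c'0 : 0 < c' by lra.
pose t := (a + e) / c'.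
have t01 : 0 <= t <= 1.
  by rewrite /t divr_ge0 ?(ltW a'0) ?(ltW c'0)//= ler_pdivrMr// mul1r c'E; lra.
have t0 : 0 < t by rewrite /t divr_gt0.
have tE : 1 - t = (b + e) / c' by rewrite /t c'E; field; lra.
have t1 : 0 < 1 - t by rewrite tE divr_gt0.
have ea := fa (a + e) _ (l / t); have eb := gb (b + e) _ (l / (1 - t)).
have {}ea : (\int[P]_x (expR (l / t * f x))%:E <= (expR (l ^+ 2 * c' ^+ 2 / 2))%:E)%E.
  apply: (le_trans (ea _)); first lra.
  rewrite lee_fin ler_expR le_eqVlt; apply/orP; left; apply/eqP.
  by rewrite /t; field; lra.
have {}eb : (\int[P]_x (expR (l / (1 - t) * g x))%:E <=
  (expR (l ^+ 2 * c' ^+ 2 / 2))%:E)%E.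
  apply: (le_trans (eb _)); first lra.
  rewrite lee_fin ler_expR le_eqVlt; apply/orP; left; apply/eqP.
  by rewrite tE; field; lra.
apply: (@le_trans _ _ (\int[P]_x (t%:E * (expR (l / t * f x))%:E + (1 - t)%:E * (expR
  (l / (1 - t) * g x))%:E))%E).
  apply: ge0_le_integral => //.
  - by apply: (@measurable_mgf (f \+ g)); exact: measurable_funD.
  - by apply: emeasurable_funD; apply: emeasurable_funM => //; exact: measurable_mgf.
  move=> x _; rewrite -!EFinM -EFinD lee_fin.
  have := @convex_expR R (Itv01 (proj1 (andP t01)) (proj2 (andP t01))) (l / t * f x)
    (l / (1 - t) * g x).
  rewrite !convRE/= /unstable.onem (_ : t * _ + _ = l * (f x + g x))//.
  by field; lra.
have mZ f' (k : R) : 0 <= k -> measurable_fun setT f' ->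
    forall l', (\int[P]_x (k%:E * (expR (l' * f' x))%:E) = k%:E * \int[P]_x (expR
      (l' * f' x))%:E)%E.
  by move=> k0 mf' l'; rewrite ge0_integralZl_EFin//; exact: measurable_mgf.
rewrite ge0_integralD//; last 4 first.
- by move=> x _; rewrite mule_ge0// lee_fin ?expR_ge0// ltW.
- by apply: emeasurable_funM => //; exact: measurable_mgf.
- by move=> x _; rewrite mule_ge0// lee_fin ?expR_ge0// ltW.
- by apply: emeasurable_funM => //; exact: measurable_mgf.
rewrite !mZ//; [|exact: ltW|exact: ltW].
rewrite [leRHS](_ : _ = t%:E * (expR (l ^+ 2 * c' ^+ 2 / 2))%:E + (1 - t)%:E * (expR
  (l ^+ 2 * c' ^+ 2 / 2))%:E)%E.
  by rewrite leeD// lee_pmul2l.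
by rewrite -!EFinM -EFinD -mulrDl addrC subrK mul1r.
Qed.

Lemma subgaussian_norm_le f c : sub_gaussian f c -> (subgaussian_norm P f <= c%:E)%E.
Proof.
move=> [mf c0 fc]; apply/lee_addgt0Pr => e e0; rewrite -EFinD.
apply: ereal_inf_lbound; exists (c + e) => //=; split; first lra.
by move=> l; rewrite unlock; apply: fc; lra.
Qed.
End SubGaussian.

(** * Multiscale bound on boxes *)

Lemma sum_blocks (V : nmodType) (I : finType) (C : {set I}) (idx : I -> nat)
    (n : nat) (F : I -> V) : (forall x, x \in C -> (idx x < n)%N) ->
  \sum_(x in C) F x = \sum_(j < n) \sum_(x in C | idx x == j) F x.
Proof.
move=> idxn; rewrite [RHS](exchange_big_dep (mem C))//=; last by move=> j x _ /andP[].
apply: eq_bigr => x xC; rewrite (big_pred1 (Ordinal (idxn x xC)))// => j /=.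
by rewrite xC/= eq_sym.
Qed.

Section GeneratedSigmaAlgebras.
Context (disp : measure_display) (T : measurableType disp) (R : realType).
Variable P : probability T R.

(** [<<s set0 >>] consists of [set0] and [setT]. This serves the coarsest scale, where nothing
    precedes. *)
Lemma cond_centered_trivial (D : T -> R) : P.-integrable setT (EFin \o D) ->
  (\int[P]_x (D x)%:E = 0)%E -> cond_centered P set0 D.
Proof.
move=> iD D0; split=> // A GA.
have : [set B | B = set0 \/ B = setT] A.
  move: A GA; apply: smallest_sub => //; split.
  - by left.
  - by move=> B [->|->]; [right|left]; rewrite ?setD0 ?setDT.
  - move=> F hF; have [[i Fi]|nF] := pselect (exists i, F i = setT).
      by right; apply/seteqP; split=> // x _; exists i => //; rewrite Fi.
    left; apply/seteqP; split=> // x [i _]; case: (hF i) => [->//|Fi].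
    by exfalso; apply: nF; exists i.
by move=> [->|->] //; rewrite integral_set0.
Qed.

Variables (I : finType) (X : I -> T -> R).

Definition gen (U : {set I}) : set (set T) :=
  \bigcup_(u in [set u | u \in U]) preimage_set_system setT (X u) measurable.

Lemma gen_sub (U V : {set I}) : U \subset V -> gen U `<=` gen V.
Proof. by move=> /fintype.subsetP UV A [u /= uU h]; exists u => //=; exact: UV. Qed.

Lemma gen_set0 : gen finset.set0 = set0.
Proof. by apply/seteqP; split=> // A [u /=]; rewrite inE. Qed.

Hypothesis mX : forall x, measurable_fun setT (X x).

Lemma gen_measurable U : gen U `<=` measurable.
Proof. by move=> A [u _ [B mB <-]]; exact: mX. Qed.

Lemma gen_measurable_wrt (U : {set I}) x : x \in U -> measurable_wrt (gen U) (X x).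
Proof.
move=> xU; apply: measurable_wrtP => B mB; apply: sub_sigma_algebra.
by exists x => //; exists B => //; rewrite setTI.
Qed.

End GeneratedSigmaAlgebras.

(* The properties shared by the [L^p] norm and the sub-Gaussian norm on which the
   multiscale argument relies: [Q f c] stands for "the norm of f is at most c". *)
Record martingale_gauge (disp : measure_display) (T : measurableType disp)
    (R : realType) (P : probability T R) (p : \bar R) (Q : (T -> R) -> R -> Prop)
    (kappa : R) : Prop := MartingaleGauge {
  gauge_ge0 : 0 <= kappa;
  gauge0 : Q (fun=> 0) 0;
  gaugeD : forall f g a b, Q f a -> Q g b -> Q (f \+ g) (a + b);
  gaugeW : forall f a b, Q f a -> a <= b -> Q f b;
  gauge_martingale : forall (n : nat) (G : nat -> set (set T))
      (D : nat -> T -> R) (c : nat -> R),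
    (forall j, G j `<=` measurable) -> (forall j, G j `<=` G j.+1) ->
    (forall j, (j < n)%N -> measurable_wrt (G j.+1) (D j)) ->
    (forall j, (j < n)%N -> cond_centered P (G j) (D j)) ->
    (forall j, (j < n)%N -> ('N[P]_p[EFin \o D j] <= (c j)%:E)%E) ->
    Q (fun w => \sum_(j < n) D j w) (kappa * Num.sqrt (\sum_(j < n) c j ^+ 2)) }.

Section Core.
Context (disp : measure_display) (T : measurableType disp) (R : realType).
Variables (P : probability T R) (p : \bar R).
Hypothesis p2 : (2%:E <= p)%E.

Lemma ge2_ge1 : (1 <= p)%E.
Proof. by apply: le_trans p2; rewrite lee_fin; lra. Qed.

Lemma Lnorm_sum (I : finType) (C : pred I) (f : I -> T -> R) (c : I -> R) :
  (forall x, C x -> measurable_fun setT (f x)) ->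
  (forall x, C x -> ('N[P]_p[EFin \o f x] <= (c x)%:E)%E) ->
  ('N[P]_p[EFin \o (fun w => \sum_(x | C x) f x w)%R] <= (\sum_(x | C x) c x)%:E)%E.
Proof.
move=> mf Nf.
suff [] : measurable_fun setT (fun w => \sum_(x | C x) f x w) /\
  ('N[P]_p[EFin \o (fun w => \sum_(x | C x) f x w)%R] <= (\sum_(x | C x) c x)%:E)%E by [].
have -> : (fun w => \sum_(x | C x) f x w) = \sum_(x | C x) f x.
  by apply/funext => w; rewrite fct_sumE.
elim/big_rec2 : _ => [|x a g Cx [mg Ng]].
  split; first exact: measurable_cst.
  rewrite (_ : _ \o _ = cst 0%E)// Lnorm0//.
  by apply: contraTN p2 => /eqP ->; rewrite -ltNge lte_fin; lra.
split; first exact: measurable_funD (mf _ Cx) mg.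
rewrite EFinD; apply: (le_trans (eminkowski _ (mf _ Cx) mg ge2_ge1)).
exact: leeD (Nf _ Cx) Ng.
Qed.

Lemma LnormB (f g : T -> R) (a b : R) : measurable_fun setT f -> measurable_fun setT g ->
  ('N[P]_p[EFin \o f] <= a%:E)%E -> ('N[P]_p[EFin \o g] <= b%:E)%E ->
  ('N[P]_p[EFin \o (f \- g)%R] <= (a + b)%:E)%E.
Proof.
move=> mf mg Nf Ng; rewrite (_ : (f \- g) = (f \+ \- g))//.
have mNg : measurable_fun setT (\- g) by exact: measurableT_comp.
apply: (le_trans (eminkowski _ mf mNg ge2_ge1)); rewrite EFinD leeD//.
by rewrite (_ : EFin \o (\- g)%R = (fun x => - (EFin \o g) x)%E)// oppe_Lnorm.
Qed.

Variables (Q : (T -> R) -> R -> Prop) (kappa : R).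
Hypothesis gaugeQ : martingale_gauge P p Q kappa.

Lemma Q_sum (n : nat) (f : nat -> T -> R) (c : nat -> R) :
  (forall k, (k < n)%N -> Q (f k) (c k)) ->
  Q (fun w => \sum_(k < n) f k w) (\sum_(k < n) c k).
Proof.
elim: n => [|n IH] h.
  rewrite big_ord0 (_ : (fun=> _) = (fun=> 0)); first exact: gauge0 gaugeQ.
  by apply/funext => w; rewrite big_ord0.
rewrite big_ord_recr/= (_ : (fun=> _) = (fun w => \sum_(k < n) f k w) \+ f n).
  by apply: (gaugeD gaugeQ); [apply: IH => k kn; apply: h; exact: ltnW|exact: h].
by apply/funext => w; rewrite big_ord_recr.
Qed.

Variables (d n : nat) (X : {ffun 'I_d -> 'I_n} -> T -> R).
Variables (M : R) (phi : nat -> R) (delta : nat -> nat).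
Hypothesis mX : forall x, measurable_fun setT (X x).
Hypothesis iX : forall x, P.-integrable setT (EFin \o X x).
Hypothesis X0 : forall x, (\int[P]_w (X x w)%:E = 0)%E.
Hypothesis NX : forall x, ('N[P]_p[EFin \o X x] <= M%:E)%E.
Hypothesis wd : forall (x : {ffun 'I_d -> 'I_n}) (r : nat) (U : {set {ffun 'I_d ->
  'I_n}}), (0 < r)%N ->
  (forall u, u \in U -> exists i, (u i + r <= x i)%N) ->
  exists Y, [/\ measurable_wrt (gen X U) Y, cond_centered P (gen X U) (X x \- Y) &
    ('N[P]_p[EFin \o Y] <= (M * phi r)%:E)%E].
Hypothesis M0 : 0 <= M.
Hypothesis phi0 : phi 0%N = 1.
Hypothesis phi_ge0 : forall r, 0 <= phi r.
Hypothesis phi_le : forall r s, (r <= s)%N -> phi s <= phi r.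
Hypothesis delta0 : delta 0%N = 0%N.
Hypothesis delta_le : forall r s, (r <= s)%N -> (delta r <= delta s)%N.

(** [M * weight k] bounds the norm of [W_k]: scale 0 is the field itself, and [W_(k'+1)] conditions
    on points at distance [delta k' + 1]. Hence the index [k.-1] in [Psi]. *)
Definition weight (k : nat) : R := if k is k'.+1 then phi (delta k' + 1)%N else 1.

Lemma weight_ge0 k : 0 <= weight k.
Proof. by case: k => [|k] //=. Qed.

Lemma weight_le k : weight k.+1 <= weight k.
Proof.
case: k => [|k] /=; first by rewrite -phi0; exact: phi_le.
by apply: phi_le; rewrite leq_add2r delta_le.
Qed.

Lemma core_bound (A : 'I_d -> {set 'I_n}) (C : {set {ffun 'I_d -> 'I_n}}) (m : nat) :
  (forall i, #|A i| <= 2 ^ m.+1)%N -> C \subset box A ->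
  (forall k x u, (k <= m)%N -> x \in C -> u \in box A ->
    (zcode m.+1 A u %/ 2 ^ (d * k) < zcode m.+1 A x %/ 2 ^ (d * k))%N ->
    exists i, (u i + (delta k + 1) <= x i)%N) ->
  Q (fun w => \sum_(x in C) X x w)
    (\sum_(k < m.+2) kappa * (2 * M * weight k *
       Num.sqrt (#|box A|%:R * (\prod_i minn (2 ^ k) #|A i|)%:R))).
Proof.
set K := m.+1; set z := zcode K A.
move=> AK /fintype.subsetP CA sep.
pose U k x := [set u in box A | (z u < 2 ^ (d * k) * (z x %/ 2 ^ (d * k)))%N].
(* The guards stand under the existential so that [choice] applies to all pairs. *)
have YE (kx : nat * {ffun 'I_d -> 'I_n}) : exists Y : T -> R,
    (kx.1 <= K)%N -> kx.2 \in C ->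
    [/\ measurable_wrt (gen X (U kx.1 kx.2)) Y,
      cond_centered P (gen X (U kx.1 kx.2)) (X kx.2 \- Y),
      ('N[P]_p[EFin \o Y] <= (M * weight kx.1.+1)%:E)%E & kx.1 = K -> Y = (fun=> 0)].
  case: kx => k x /=.
  have [|kK] := boolP ((k <= K)%N && (x \in C)); last first.
    by exists (fun=> 0) => h1 h2; rewrite h1 h2 in kK.
  case/andP => kK xC.
  move: (kK); rewrite leq_eqVlt => /predU1P[->|kltK].
    (* At the top scale one cube contains the whole box: its past is empty, the conditional
       expectation is the mean 0, and the telescoping sum ends there. *)
    exists (fun=> 0) => _ _.
    have -> : U K x = finset.set0.
      by apply/finset.setP => u; rewrite !inE divn_small ?morton_lt// muln0 ltn0 andbF.
    rewrite gen_set0; split => //; first exact: measurable_cst.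
      rewrite (_ : X x \- _ = X x); first exact: cond_centered_trivial.
      by apply/funext => w; rewrite /= subr0.
    rewrite (_ : _ \o _ = cst 0%E)// Lnorm0;
      first by rewrite lee_fin mulr_ge0 ?weight_ge0.
    by apply: contraTN p2 => /eqP ->; rewrite -ltNge lte_fin; lra.
  have [||Y [gY oY NY]] := @wd x (delta k + 1) (U k x); first by rewrite addn1.
    move=> u; rewrite inE => /andP[uA lt]; apply: sep => //.
    by rewrite ltn_divLR ?expn_gt0// mulnC.
  by exists Y => _ _; split=> // e; rewrite e ltnn in kltK.
have [Y0 HY0] := choice YE.
pose Y k x := Y0 (k, x).
have HY k x : (k <= K)%N -> x \in C -> [/\ measurable_wrt (gen X (U k x)) (Y k x),
   cond_centered P (gen X (U k x)) (X x \- Y k x), ('N[P]_p[EFin \o Y k x] <=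
     (M * weight k.+1)%:E)%E &
   k = K -> Y k x = (fun=> 0)].
  by move=> kK xC; exact: (HY0 (k, x)).
pose W k x := if k is k'.+1 then Y k' x else X x.
have gX U' := @gen_measurable _ _ _ _ _ mX U'.
have mW k x : (k <= K.+1)%N -> x \in C -> measurable_fun setT (W k x).
  case: k => [|k] // kK xC; have [gY _ _ _] := HY k x kK xC.
  exact: measurable_wrt_measurable (gX _) gY.
have NW k x : (k <= K.+1)%N -> x \in C -> ('N[P]_p[EFin \o W k x] <= (M * weight k)%:E)%E.
  case: k => [|k] kK xC; first by rewrite /= mulr1.
  by have [] := HY k x kK xC.
have ND k x : (k <= K)%N -> x \in C ->
    ('N[P]_p[EFin \o (W k x \- W k.+1 x)%R] <= (2 * M * weight k)%:E)%E.
  move=> kK xC.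
  have kK' : (k <= K.+1)%N by exact: leqW.
  apply: (le_trans (LnormB (mW _ _ kK' xC) (mW k.+1 _ kK xC) (NW _ _ kK' xC)
    (NW k.+1 _ kK xC))).
  rewrite lee_fin; have := ler_wpM2l M0 (weight_le k); lra.
(* A larger cube that precedes consists of smaller ones that precede, so the pasts shrink as the
   scale grows. *)
have US k x : U k.+1 x \subset U k x.
  apply/fintype.subsetP => u; rewrite !inE => /andP[-> /=] /leq_trans; apply.
  rewrite mulnS expnD -mulnA mulnCA leq_mul2l leq_divRL ?expn_gt0//.
  by rewrite mulnAC [X in (X <= _)%N]mulnC leq_trunc_div orbT.
(* For k > 0, W_k - W_(k+1) = (X - W_(k+1)) - (X - W_k), and the last difference is centered given a
   past that contains [U k x]. *)
have oW k x : (k <= K)%N -> x \in C ->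
  cond_centered P (gen X (U k x)) (W k x \- W k.+1 x).
  move=> kK xC; have [_ oY _ _] := HY k x kK xC.
  case: k kK oY => [|k] kK oY //.
  have [_ oY' _ _] := HY k x (ltnW kK) xC.
  have {}oY' := cond_centeredW (subset_trans (gen_sub (US k x))
    (@sub_sigma_algebra _ _ _)) oY'.
  have := cond_centeredD (gX _) oY (cond_centeredN (gX _) oY'); congr cond_centered.
  by apply/funext => w /=; ring.
pose D k j w := \sum_(x in C | (z x %/ 2 ^ (d * k))%N == j) (W k x w - W k.+1 x w).
have -> : (fun w => \sum_(x in C) X x w) =
    (fun w => \sum_(k < K.+1) \sum_(j < 2 ^ (d * (K - k))) D k j w).
  apply/funext => w.
  transitivity (\sum_(k < K.+1) \sum_(x in C) (W k x w - W k.+1 x w)).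
    rewrite exchange_big/=; apply: eq_bigr => x xC.
    rewrite -(big_mkord xpredT (fun k => W k x w - W k.+1 x w)).
    under eq_bigr do rewrite -opprB.
    rewrite sumrN telescope_sumr// opprB /=.
    by have [_ _ _ ->] := HY K x (leqnn _) xC; rewrite ?subr0.
  apply: eq_bigr => k _; rewrite /D.
  apply: (@sum_blocks R _ C (fun x => z x %/ 2 ^ (d * k))%N) => x xC.
  rewrite ltn_divLR ?expn_gt0// -expnD -mulnDr subnK ?morton_lt//.
  by rewrite -ltnS ltn_ord.
apply: (@Q_sum K.+1 (fun k w => \sum_(j < 2 ^ (d * (K - k))) D k j w)
  (fun k => kappa * (2 * M * weight k *
     Num.sqrt (#|box A|%:R * (\prod_i minn (2 ^ k) #|A i|)%:R)))) => k kK.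
pose c j : R := #|[set x in C | (z x %/ 2 ^ (d * k))%N == j]|%:R * (2 * M * weight k).
pose V j := [set u in box A | (z u < 2 ^ (d * k) * j)%N].
have UV x j : (z x %/ 2 ^ (d * k))%N = j -> U k x = V j by move=> <-.
have D0 : (0 < 2 ^ (d * k))%N by rewrite expn_gt0.
have VS j j' : (j <= j')%N -> V j \subset V j'.
  move=> jj; apply/fintype.subsetP => u; rewrite !inE => /andP[-> /=] /leq_trans; apply.
  by rewrite leq_mul2l jj orbT.
have zlt x j : (z x %/ 2 ^ (d * k))%N = j -> (z x < 2 ^ (d * k) * j.+1)%N.
  by move=> <-; rewrite mulnC ltn_ceil.
(* [W_k] at [x] depends on cubes of side 2^(k-1) coded before [x]; these lie in the blocks of side
   2^k numbered at most [j]. *)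
have gW x j : x \in C -> (z x %/ 2 ^ (d * k))%N = j ->
    measurable_wrt (gen X (V j.+1)) (W k x) /\ measurable_wrt (gen X (V j.+1)) (W k.+1 x).
  move=> xC zx; split; last first.
    have [gY _ _ _] := HY k x kK xC.
    apply: measurable_wrtW gY; rewrite (UV _ _ zx).
    apply: subset_trans (@sub_sigma_algebra _ _ _); apply: gen_sub.
    exact: VS.
  have [k0|k_gt0] := posnP k.
    have -> : W k x = X x by rewrite k0.
    by apply: gen_measurable_wrt; rewrite inE CA// zlt.
  have -> : W k x = Y k.-1 x by rewrite -{1}(prednK k_gt0).
  have kK' : (k.-1 <= K)%N by rewrite -ltnS prednK// ltnW.
  have [gY _ _ _] := HY k.-1 x kK' xC.
  apply: measurable_wrtW gY; apply: subset_trans (@sub_sigma_algebra _ _ _);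
    apply: gen_sub.
  apply/fintype.subsetP => u; rewrite !inE => /andP[-> /=] /leq_trans; apply.
  by rewrite (leq_trans _ (ltnW (zlt x j zx)))// mulnC leq_trunc_div.
apply: (gaugeW gaugeQ (@gauge_martingale _ _ _ _ _ _ _ gaugeQ (2 ^ (d * (K - k)))
  (fun j => gen X (V j)) (D k) c (fun j => gX _) _ _ _ _)).
- by move=> j; apply: gen_sub; exact: VS.
- move=> j _; rewrite /D (_ : (fun w =>
    _) = \sum_(x in C | (z x %/ 2 ^ (d * k))%N == j) (W k x \- W k.+1 x)).
    elim/big_rec : _ => [|x f /andP[xC /eqP zx] mf]; first exact: measurable_cst.
    have [g1 g2] := gW x j xC zx.
    by apply: measurable_funD => //; exact: measurable_funB.
  by apply/funext => w; rewrite fct_sumE.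
- move=> j _; rewrite /D (_ : (fun w =>
    _) = \sum_(x in C | (z x %/ 2 ^ (d * k))%N == j) (W k x \- W k.+1 x)).
    elim/big_rec : _ => [|x f /andP[xC /eqP zx] mf]; first exact: cond_centered0.
    by apply: cond_centeredD => //; rewrite -(UV x j zx); exact: oW.
  by apply/funext => w; rewrite fct_sumE.
- move=> j _; rewrite /c mulr_natl -sumr_const (eq_bigl (fun x =>
    (x \in C) && ((z x %/ 2 ^ (d * k))%N == j))).
    apply: Lnorm_sum => x /andP[xC _]; last exact: ND.
    by apply: measurable_funB; apply: mW => //; exact: leqW.
  by move=> x; rewrite inE.
rewrite ler_wpM2l ?(gauge_ge0 gaugeQ)//.
have w0 : 0 <= 2 * M * weight k by rewrite !mulr_ge0// weight_ge0.
rewrite -[X in X * _](ger0_norm w0) -sqrtr_sqr -sqrtrM ?sqr_ge0// ler_wsqrtr//.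
(* The squared block sizes sum to at most the largest block size times the number of points, whence
   the square root of a product of two cardinalities. *)
rewrite (_ : \sum_(j < _) _ = (2 * M * weight k) ^+ 2 *
    (\sum_(j < 2 ^ (d * (K - k))) #|[set x in C | (z x %/ 2 ^
      (d * k))%N == j]| ^ 2)%:R); last first.
  by rewrite natr_sum mulr_sumr; apply: eq_bigr => j _; rewrite /c exprMn natrX mulrC.
rewrite ler_wpM2l ?sqr_ge0// -natrM ler_nat.
set B := (\prod_i _)%N.
apply: (@leq_trans (\sum_(j < 2 ^ (d * (K - k))) #|[set x in C | (z x %/ 2 ^
  (d * k))%N == j]| * B)).
  apply: leq_sum => j _; rewrite expnS expn1 leq_mul2l; apply/orP; right.
  apply: leq_trans (zcode_block_card (k := k) j _ AK); last by rewrite -ltnS.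
  apply: subset_leq_card; apply/fintype.subsetP => x; rewrite !inE => /andP[xC ->].
  by rewrite andbT; have := CA x xC; rewrite inE.
rewrite -big_distrl/= leq_mul2r; apply/orP; right.
apply: leq_trans (subset_leq_card (introT fintype.subsetP CA)).
rewrite -[X in (_ <= X)%N]sum1_card (@sum_blocks _ _ C (fun x =>
  z x %/ 2 ^ (d * k))%N (2 ^ (d * (K - k)))).
  apply: leq_sum => j _; rewrite -sum1_card; apply: eq_leq; apply: eq_bigl => x;
    by rewrite inE.
move=> x xC; rewrite ltn_divLR ?expn_gt0// -expnD -mulnDr subnK ?morton_lt//.
Qed.
Variables (m : nat).
Hypothesis d_gt0 : (0 < d)%N.
Hypothesis delta_sum : \sum_(1 <= k < m.+1) (delta k)%:R / 2 ^+ k <=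
  1 / (4 * d%:R ^+ 2) :> R.

(** [Psi] for a general box: on a rectangle the product of minima is the cardinality of its
    intersection with C_k. It depends on the sides through their cardinalities only, and
    monotonically. *)
Definition box_psi (A : 'I_d -> {set 'I_n}) : R :=
  2 * M * Num.sqrt #|box A|%:R *
  (2 + \sum_(1 <= k < m.+2)
    phi (delta k.-1 + 1)%N * Num.sqrt (\prod_i minn (2 ^ k) #|A i|)%:R).

Lemma box_psi_sum_ge0 (A : 'I_d -> {set 'I_n}) :
  0 <= \sum_(1 <= k < m.+2)
    phi (delta k.-1 + 1)%N * Num.sqrt (\prod_i minn (2 ^ k) #|A i|)%:R.
Proof. by apply: sumr_ge0 => k _; rewrite mulr_ge0// sqrtr_ge0. Qed.

Lemma box_psi_ge0 A : 0 <= box_psi A.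
Proof.
rewrite /box_psi !mulr_ge0 ?sqrtr_ge0//.
by have := box_psi_sum_ge0 A; lra.
Qed.

Lemma core_weights_le (A : 'I_d -> {set 'I_n}) :
  \sum_(k < m.+2) kappa * (2 * M * weight k *
       Num.sqrt (#|box A|%:R * (\prod_i minn (2 ^ k) #|A i|)%:R)) <= kappa * box_psi A.
Proof.
rewrite -mulr_sumr ler_wpM2l ?(gauge_ge0 gaugeQ)// /box_psi -mulrA.
under eq_bigr do rewrite -mulrA sqrtrM// [weight _ * _]mulrCA.
rewrite -mulr_sumr ler_wpM2l ?mulr_ge0// -mulr_sumr ler_wpM2l ?sqrtr_ge0//.
rewrite big_ord_recl/= mul1r lerD//; last first.
  by rewrite big_add1/= big_mkord.
(* At scale 0 the blocks are single points; this term is absorbed by the constant 2 of [Psi]. *)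
apply: (@le_trans _ _ 1); last lra.
rewrite -[leRHS]sqrtr1 ler_wsqrtr// -[leRHS](mulr1n 1) ler_nat.
apply: (@leq_trans (\prod_(i < d) 1)%N); last by rewrite big1.
apply: leq_prod => i _; by rewrite expn0 geq_minl.
Qed.

Lemma gap_box_card (A B : 'I_d -> {set 'I_n}) (k : 'I_d) :
  (forall i, B i \subset A i) -> B k \subset gap delta m (A k) ->
  #|box B|%:R <= #|box A|%:R * (1 / (2 * d%:R)) ^+ 2 :> R.
Proof.
move=> BA Bk.
have d0 : 0 < d%:R :> R by rewrite ltr0n.
have AB i : (#|B i| <= #|A i|)%N by apply: subset_leq_card.
rewrite !card_box (bigD1 k)//= [in leRHS](bigD1 k)//= !natrM mulrAC.
apply: ler_pM; rewrite ?ler_nat//; last first.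
  by apply: leq_prod => i _.
apply: (@le_trans _ _ #|gap delta m (A k)|%:R).
  by rewrite ler_nat; exact: subset_leq_card.
apply: (le_trans (card_gap delta m R (A k))); rewrite ler_wpM2l//.
apply: (le_trans delta_sum); rewrite le_eqVlt; apply/orP; left; apply/eqP.
by field; lra.
Qed.

(** The leading square root gains the factor 1/(2 d), while the sum over scales can only decrease
    with the sides. *)
Lemma gap_box_psi (A B : 'I_d -> {set 'I_n}) (k : 'I_d) :
  (forall i, B i \subset A i) -> B k \subset gap delta m (A k) ->
  box_psi B <= box_psi A / (2 * d%:R).
Proof.
move=> BA Bk.
have d0 : 0 < d%:R :> R by rewrite ltr0n.
have AB i : (#|B i| <= #|A i|)%N by apply: subset_leq_card.
have card := gap_box_card BA Bk.
have sq : Num.sqrt #|box B|%:R <= Num.sqrt #|box A|%:R / (2 * d%:R) :> R.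
  apply: (le_trans (ler_wsqrtr card)).
  rewrite sqrtrM// sqrtr_sqr ger0_norm ?mul1r// ?divr_ge0// mulr_ge0//; lra.
rewrite /box_psi [leRHS](_ : _ = 2 * M * (Num.sqrt #|box A|%:R / (2 * d%:R)) *
  (2 + \sum_(1 <= k < m.+2)
    phi (delta k.-1 + 1)%N * Num.sqrt (\prod_i minn (2 ^ k) #|A i|)%:R)); last first.
  by field; lra.
apply: ler_pM; rewrite ?mulr_ge0 ?sqrtr_ge0//.
- by have := box_psi_sum_ge0 B; lra.
- by rewrite ler_wpM2l// mulr_ge0.
rewrite lerD2l; apply: ler_sum => j _; rewrite ler_wpM2l// ler_wsqrtr// ler_nat.
apply: leq_prod => i _; rewrite leq_min geq_minl/=.
by rewrite (leq_trans (geq_minr _ _)).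
Qed.

Lemma box_bound (A : 'I_d -> {set 'I_n}) : (forall i, #|A i| <= 2 ^ m.+1)%N ->
  Q (fun w => \sum_(x in box A) X x w) (2 * kappa * box_psi A).
Proof.
move: {2}(#|box A|) (leqnn #|box A|) => N.
elim: N A => [|N IH] A AN AK.
  move: AN; rewrite leqn0 cards_eq0 => /eqP A0.
  rewrite (_ : (fun=> _) = (fun=> 0)); last by apply/funext => w; rewrite A0 big_set0.
  by apply: (gaugeW gaugeQ (gauge0 gaugeQ)); apply: mulr_ge0;
    rewrite ?box_psi_ge0 ?mulr_ge0 ?(gauge_ge0 gaugeQ).
have [A0|A0] := eqVneq (box A) finset.set0.
  by apply: IH => //; rewrite A0 cards0.
have d0 : 0 < d%:R :> R by rewrite ltr0n.
(* [B k] holds the points whose first coordinate in a gap is [k], and [C k] those with no coordinate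
   below [k] in a gap. Splitting by the first such coordinate makes the pieces disjoint boxes; [C d]
   is the separated core. *)
pose C k (i : 'I_d) := if (i < k)%N then A i :\: gap delta m (A i) else A i.
pose B k (i : 'I_d) := if (i < k)%N then A i :\: gap delta m (A i) else
  if (i == k :> nat) then gap delta m (A i) else A i.
have CA k i : C k i \subset A i.
  by rewrite /C; case: ifP => _ //; exact: subsetDl.
have BA k i : B k i \subset A i.
  rewrite /B; case: ifP => _; first exact: subsetDl.
  by case: ifP => _ //; exact: gap_sub.
have step k w : (k < d)%N -> \sum_(x in box (C k)) X x w =
    \sum_(x in box (B k)) X x w + \sum_(x in box (C k.+1)) X x w.
  move=> kd; rewrite (bigID (fun x => x \in box (B k)))/=; congr (_ + _).
    apply: eq_bigl => x; apply: andb_idl => /boxP xB; apply/boxP => i.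
    have := xB i; rewrite /B /C; case: ifP => // _; case: ifP => // _.
    exact: (fintype.subsetP (gap_sub _ _ _)).
  apply: eq_bigl => x; apply/andP/boxP => [[/boxP xC xB] i|xC].
    have := xC i; rewrite /C ltnS; case: (ltngtP i k) => //= ik xi.
    rewrite finset.in_setD xi andbT; apply: contra xB => xg; apply/boxP => j.
    rewrite /B; have := xC j; rewrite /C; case: ifP => // jk xj.
    case: eqP => // jk'; have -> // : j = i.
    by apply/val_inj; rewrite /= jk' ik.
  split.
    apply/boxP => i; have := xC i; rewrite /C ltnS; case: (ltngtP i k) => //= _.
    by rewrite inE => /andP[].
  apply/negP => /boxP /(_ (Ordinal kd)).
  have := xC (Ordinal kd); rewrite /B /C /= ltnn ltnSn eqxx inE.
  by case/andP => /negP.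
have total w : \sum_(x in box A) X x w =
    \sum_(k < d) \sum_(x in box (B k)) X x w + \sum_(x in box (C d)) X x w.
  have -> : \sum_(x in box A) X x w = \sum_(x in box (C 0)) X x w by [].
  suff H k : (k <= d)%N -> \sum_(x in box (C 0)) X x w =
      \sum_(j < k) \sum_(x in box (B j)) X x w + \sum_(x in box (C k)) X x w.
    exact: H.
  elim: k => [|k IHk] kd; first by rewrite big_ord0 add0r.
  by rewrite (IHk (ltnW kd)) big_ord_recr/= step// addrA.
have psiB k : (k < d)%N -> box_psi (B k) <= box_psi A / (2 * d%:R).
  move=> kd; apply: (@gap_box_psi A (B k) (Ordinal kd)) => //.
  by rewrite /B /= ltnn eqxx.
have QB k : (k < d)%N -> Q (fun w => \sum_(x in box (B k)) X x w)
    (kappa * box_psi A / d%:R).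
  (* The induction on cardinality advances: since 1/(2 d) <= 1/2, a nonempty box loses at least
     three quarters of its points. *)
  move=> kd; have BN : (#|box (B k)| <= N)%N.
    rewrite -ltnS; apply: leq_trans AN; rewrite -(ltr_nat R).
    apply: (le_lt_trans (@gap_box_card A (B k) (Ordinal kd) (BA k) _)).
      by rewrite /B /= ltnn eqxx.
    have boxA : 0 < #|box A|%:R :> R by rewrite ltr0n card_gt0.
    have d1 : 1 <= d%:R :> R by rewrite ler1n.
    have h0 : 0 <= 1 / (2 * d%:R) :> R by rewrite divr_ge0// mulr_ge0.
    have h1 : 1 / (2 * d%:R) <= 1 / 2 :> R by rewrite ler_pdivrMr; lra.
    rewrite gtr_pMr// expr2; nra.
  have BK i : (#|B k i| <= 2 ^ m.+1)%N.
    exact: leq_trans (subset_leq_card (BA k i)) (AK i).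
  apply: (gaugeW gaugeQ (IH (B k) BN BK)).
  rewrite (_ : _ / _ = 2 * kappa * (box_psi A / (2 * d%:R))); last by field; lra.
  by rewrite ler_wpM2l ?mulr_ge0 ?(gauge_ge0 gaugeQ)// psiB.
have QC : Q (fun w => \sum_(x in box (C d)) X x w) (kappa * box_psi A).
  apply: (gaugeW gaugeQ _ (core_weights_le A)).
  apply: (core_bound) => //.
    apply/fintype.subsetP => x /boxP xC; apply/boxP => i.
    exact: (fintype.subsetP (CA d i)).
  move=> k x u km xC uA lt.
  apply: (@core_separated d n m.+1 delta m A k x u) => //; first exact: leqW.
  apply/boxP => i; have /boxP/(_ i) := xC.
  by rewrite /C ltn_ord.
rewrite (_ : (fun w => _) = (fun w => \sum_(k < d) \sum_(x in box (B k)) X x w) \+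
    (fun w => \sum_(x in box (C d)) X x w)); last by apply/funext => w; rewrite total.
rewrite (_ : 2 * kappa * box_psi A = \sum_(k < d)
  (kappa * box_psi A / d%:R) + kappa * box_psi A).
  apply: (gaugeD gaugeQ _ QC).
  exact: (@Q_sum d (fun k w => \sum_(x in box (B k)) X x w) (fun=>
    kappa * box_psi A / d%:R)).
rewrite sumr_const card_ord -mulr_natr; field; lra.
Qed.
End Core.

(** * Rectangles *)

Section Rectangles.
Variables (d n : nat).

Definition site_of (x : {ffun 'I_d -> 'I_n}) : site d := [ffun i => Posz (x i).+1].

Lemma site_of_inj : injective site_of.
Proof.
move=> x y /ffunP E; apply/ffunP => i; apply/val_inj.
by have := E i; rewrite !ffunE => -[].
Qed.

Definition sides (N : 'I_d -> nat) (i : 'I_d) : {set 'I_n} :=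
  [set a : 'I_n | (a < N i)%N]%SET.

Lemma card_sides N i : (N i <= n)%N -> #|sides N i| = N i.
Proof.
move=> Nn; rewrite -sum1dep_card -(big_ord_widen_cond n xpredT (fun=> 1%N) Nn)/=.
by rewrite sum1_card card_ord.
Qed.

Lemma rect_image N : (forall i, N i <= n)%N ->
  rect N = site_of @` [set x | x \in box (sides N)].
Proof.
move=> Nn; apply/seteqP; split=> [t tN|_ [x /= /boxP xN <-] i]; last first.
  have := xN i; rewrite inE ffunE; lia.
have H i : (`|t i|.-1 < n)%N by have := tN i; have := Nn i; lia.
exists [ffun i => Ordinal (H i)].
  by apply/boxP => i; rewrite inE ffunE/=; have := tN i; lia.
by apply/ffunP => i; rewrite !ffunE/=; have := tN i; lia.
Qed.

Lemma rect_enum (N : 'I_d -> nat) : (forall i, N i <= n)%N ->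
  perm_eq (fset_set (rect N)) [seq site_of x | x <- enum (box (sides N))].
Proof.
move=> Nn; have fin : finite_set (rect N).
  by rewrite (rect_image Nn); apply: finite_image; exact: finite_finset.
apply: uniq_perm; first exact: fset_uniq.
  by rewrite map_inj_uniq ?enum_uniq//; exact: site_of_inj.
move=> t; rewrite in_fset_set// rect_image//; apply/idP/mapP.
  by rewrite inE => -[x /= xB <-]; exists x; rewrite ?mem_enum.
by move=> [x]; rewrite mem_enum => xB ->; rewrite inE; exists x.
Qed.

Lemma card_rect (N : 'I_d -> nat) : (forall i, N i <= n)%N ->
  Defs.card (rect N) = (\prod_i N i)%N.
Proof.
move=> Nn; rewrite /Defs.card (perm_size (rect_enum Nn)) size_map -cardE card_box.
by apply: eq_bigr => i _; exact: card_sides.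
Qed.

Lemma sum_rect (V : nmodType) (N : 'I_d -> nat) (f : site d -> V) : (forall i, N i <=
  n)%N ->
  \sum_(t \in rect N) f t = \sum_(x in box (sides N)) f (site_of x).
Proof.
move=> Nn; rewrite fsbig_finite; last first.
  by rewrite (rect_image Nn); apply: finite_image; exact: finite_finset.
by rewrite (perm_big _ (rect_enum Nn)) big_map big_enum.
Qed.

Lemma cube_rect k (N : 'I_d -> nat) : cube d k `&` rect N = rect (fun i =>
  minn (2 ^ k) (N i)).
Proof.
apply/seteqP; split=> [t [h1 h2] i|t h].
  by have := h1 i; have := h2 i; lia.
by split=> i; have := h i; lia.
Qed.

End Rectangles.

(** * From weak dependence on the lattice to finite boxes *)

Section Field.
Context (disp : measure_display) (T : measurableType disp) (R : realType).
Variables (P : probability T R) (d n : nat) (p : \bar R).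
Hypothesis p2 : (2%:E <= p)%E.
Variable X : site d -> {RV P >-> R}.
Hypothesis X_integrable : forall t, P.-integrable setT (EFin \o X t).
Variables (M : R) (phi : nat -> R).
Hypothesis X_WD : WD P X p M phi.

Let Xc (x : {ffun 'I_d -> 'I_n}) := centered P (X (site_of x)).

Lemma measurable_centered t : measurable_fun setT (centered P (X t)).
Proof. by apply: measurable_funB. Qed.

Lemma integrable_centered t : P.-integrable setT (EFin \o centered P (X t)).
Proof.
rewrite (_ : _ \o _ = (EFin \o X t) \- (EFin \o cst (fine 'E_P[X t])))%E//.
by apply: integrableB => //; exact: finite_measure_integrable_cst.
Qed.

Lemma integral_centered t : (\int[P]_w (centered P (X t) w)%:E = 0)%E.
Proof.
have E : ('E_P[X t] = \int[P]_w (X t w)%:E)%E by rewrite unlock.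
under eq_integral do rewrite /centered EFinB.
rewrite integralB//; [|exact: X_integrable|exact: finite_measure_integrable_cst].
have PT : (\int[P]_w (fine 'E_P[X t])%:E = (fine 'E_P[X t])%:E)%E.
  rewrite integral_cst//; transitivity ((fine 'E_P[X t])%:E * 1)%E; last by rewrite mule1.
  by congr (_ * _)%E; exact: probability_setT.
by rewrite PT E fineK ?subee//; exact: (integrable_fin_num measurableT (X_integrable t)).
Qed.

(** Tower property: the sites of [U] generate a sigma-algebra inside the past of [x], so [Z] is also
    a conditional expectation of the centered [Y], and conditioning contracts the norm. *)
Lemma WD_box (x : {ffun 'I_d -> 'I_n}) (r : nat) (U : {set {ffun 'I_d -> 'I_n}}) :
  (0 < r)%N -> (forall u, u \in U -> exists i, (u i + r <= x i)%N) ->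
  exists Y, [/\ measurable_wrt (gen Xc U) Y, cond_centered P (gen Xc U) (Xc x \- Y) &
    ('N[P]_p[EFin \o Y] <= (M * phi r)%:E)%E].
Proof.
move=> r0 Ux; have [_ _ wd] := X_WD.
have [Y [[mY iY eY] NY]] := wd (site_of x) r r0.
have mX u : measurable_fun setT (Xc u) by exact: measurable_centered.
have GT := @gen_measurable _ _ _ _ _ mX U.
have [Z gZ oZ] := cond_expectation_ex GT (integrable_centered (site_of x)).
exists Z; split=> //.
pose H := \bigcup_(u in [set u : site d | exists i, r%:Z <= site_of x i - u i])
  preimage_set_system setT (X u) measurable.
pose Y' w := Y w - fine 'E_P[X (site_of x)].
(* Centering subtracts a constant, which adds no event to the generated sigma-algebra. *)
have GH : gen Xc U `<=` <<s H >>.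
  move=> A [u /= uU [B mB <-]]; apply: sub_sigma_algebra.
  exists (site_of u).
    have [i hi] := Ux u uU; exists i; rewrite !ffunE.
    move: hi; move: (nat_of_ord (u i)) (nat_of_ord (x i)) => a b; lia.
  exists ((fun y => y - fine 'E_P[X (site_of u)]) @^-1` B) => //.
  rewrite -[X in measurable X]setTI.
  have : measurable_fun setT (fun y : R => y - fine 'E_P[X (site_of u)]).
    exact: measurable_funB.
  exact.
have HT : H `<=` measurable.
  by move=> A [u _ [B mB <-]]; exact: (measurable_funP (X u)).
have iY' : P.-integrable setT (EFin \o Y).
  exact: iY.
have oY : cond_centered P H (X (site_of x) \- Y).
  split.
    rewrite (_ : _ \o _ = (EFin \o X (site_of x)) \- (EFin \o Y))%E//.
    exact: integrableB.
  move=> A HA; have mA := subalgebra_measurable HT HA.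
  under eq_integral do rewrite /= EFinB.
  have iXA := integrableS measurableT mA (@subsetT _ _) (X_integrable (site_of x)).
  have iYA := integrableS measurableT mA (@subsetT _ _) iY.
  by rewrite integralB// (eY _ HA) subee//; exact: integrable_fin_num.
have oYZ : cond_centered P (gen Xc U) (Y' \- Z).
  have := cond_centeredD GT oZ (cond_centeredN GT (cond_centeredW GH oY));
    congr cond_centered.
  by apply/funext => w; rewrite /Y' /Xc /centered /=; ring.
apply: le_trans NY.
apply: (le_trans (Lnorm_contract p2 GT gZ oYZ)).
rewrite le_eqVlt; apply/orP; left; apply/eqP; apply: eq_Lnorm => w.
by rewrite /Y' /=; congr EFin; ring.
Qed.
End Field.

Section RectBound.
Context (disp : measure_display) (T : measurableType disp) (R : realType).
Variables (P : probability T R) (p : \bar R).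
Hypothesis p2 : (2%:E <= p)%E.
Variables (Q : (T -> R) -> R -> Prop) (kappa : R).
Hypothesis gaugeQ : martingale_gauge P p Q kappa.
Variables (d : nat) (N : 'I_d -> nat) (delta : nat -> nat).
Hypothesis d_gt0 : (0 < d)%N.
Hypothesis delta0 : delta 0%N = 0%N.
Hypothesis delta_le : forall m n : nat, (m <= n)%N -> (delta m <= delta n)%N.
Hypothesis delta_sum : \sum_(1 <= k < (max_log N).+1) (delta k)%:R / 2 ^+ k
               <= 1 / (4 * d%:R ^+ 2) :> R.
Variable X : site d -> {RV P >-> R}.
Hypothesis X_integrable : forall t, P.-integrable setT (EFin \o X t).
Variables (M : R) (phi : nat -> R).
Hypothesis X_WD : WD P X p M phi.
Hypothesis X_WD0 : forall t,
    ('N[P]_p[EFin \o centered P (X t)] <= (M * phi 0%N)%:E)%E.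

Lemma WD_const_ge0 : 0 <= M.
Proof.
have [_ phi0 _] := X_WD.
have := X_WD0 [ffun=> 0]; rewrite phi0 mulr1.
by move=> /(le_trans (Lnorm_ge0 _ _ _)).
Qed.

Lemma WD_phi_ge0 r : M != 0 -> 0 <= phi r.
Proof.
move=> M0; have [_ phi0 wd] := X_WD.
case: r => [|r]; first by rewrite phi0.
have [Y [_ NY]] := wd [ffun=> 0] r.+1 (ltn0Sn r).
have := le_trans (Lnorm_ge0 _ _ _) NY; rewrite lee_fin pmulr_rge0//.
by rewrite lt_neqAle eq_sym M0 WD_const_ge0.
Qed.

Lemma Psi_ge0 : 0 <= Psi N delta M phi.
Proof.
have M0 := WD_const_ge0.
have [->|/WD_phi_ge0 phi_ge0] := eqVneq M 0; first by rewrite /Psi mulr0 !mul0r.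
rewrite /Psi !mulr_ge0 ?sqrtr_ge0// addr_ge0//.
by apply: sumr_ge0 => k _; rewrite mulr_ge0 ?sqrtr_ge0.
Qed.

(* [phi] may be negative when [M = 0], hence the truncation at 0. *)
Lemma rect_bound : Q (rect_sum P X N) (2 * kappa * Psi N delta M phi).
Proof.
have M0 := WD_const_ge0.
have [phi_le phi0 _] := X_WD.
pose n := \max_i N i.
have Nn i : (N i <= n)%N by exact: leq_bigmax.
pose phi' r := Num.max (phi r) 0.
have Mphi r : M * phi' r = M * phi r.
  have [->|/WD_phi_ge0 phi_ge0] := eqVneq M 0; first by rewrite !mul0r.
  by rewrite /phi' max_l.
have -> : Psi N delta M phi = box_psi M phi' delta (max_log N) (@sides d n N).
  rewrite /Psi /box_psi (card_rect Nn) card_box.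
  rewrite (_ : \prod_i #|sides n N i| = \prod_i N i)%N; last first.
    by apply: eq_bigr => i _; exact: card_sides.
  set S := \sum_(1 <= k < _) _; set S' := \sum_(1 <= k < _) _.
  have MS : M * S = M * S'.
    rewrite !mulr_sumr; apply: eq_bigr => k _; rewrite !mulrA -Mphi.
    rewrite cube_rect (@card_rect d n)// => [|i]; last first.
      by rewrite (leq_trans (geq_minr _ _)).
    by congr (_ * Num.sqrt _%:R); apply: eq_bigr => i _; rewrite card_sides.
  set a := Num.sqrt _.
  rewrite (_ : _ * (2 + S) = 2 * a * (2 * M + M * S)); last by ring.
  by rewrite MS; ring.
rewrite (_ : rect_sum P X N = (fun w =>
  \sum_(x in box (sides n N)) centered P (X (site_of x)) w)).
  apply: (box_bound p2 gaugeQ (M := M) (phi := phi') (delta := delta)) => //.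
  - by move=> x; exact: measurable_centered.
  - by move=> x; exact: integrable_centered.
  - by move=> x; exact: integral_centered.
  - by move=> x; have := X_WD0 (site_of x); rewrite phi0 mulr1.
  - by move=> x r U r0 Ux; rewrite Mphi; exact: (WD_box p2 X_integrable X_WD r0 Ux).
  - by rewrite /phi' phi0 max_l.
  - by move=> r; rewrite /phi' le_max lexx orbT.
  - by move=> r s rs; rewrite /phi' ge_max !le_max lexx orbT phi_le.
  (* Since N_i < 2^(floor(log_2 N_i) + 1), one cube of side 2^(m + 1) covers the rectangle; this is
     the last scale summed in [Psi]. *)
  - move=> i; rewrite card_sides// ltnW//.
    apply: (leq_trans (trunc_log_ltn (N i) (ltnSn 1))).
    by rewrite leq_exp2l// ltnS /max_log; exact: (leq_bigmax i).
by apply/funext => w; rewrite /rect_sum (sum_rect _ Nn).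
Qed.
End RectBound.

(** * The two gauges and the final constants *)

(** Measurability is part of the gauge because adding two bounds goes through Minkowski's
    inequality. *)
Lemma Lnorm_gauge (disp : measure_display) (T : measurableType disp) (R : realType)
    (P : probability T R) (q : R) : 2 <= q ->
  martingale_gauge P q%:E
    (fun f c => measurable_fun setT f /\ ('N[P]_q%:E[EFin \o f] <= c%:E)%E)
    (2 * Num.sqrt q).
Proof.
move=> q2; split.
- by rewrite mulr_ge0 ?sqrtr_ge0.
- split; first exact: measurable_cst.
  by rewrite (_ : _ \o _ = cst 0%E)// Lnorm0// eqe gt_eqF//; lra.
- move=> f g a b [mf Nf] [mg Ng]; split; first exact: measurable_funD.
  by rewrite EFinD (le_trans (eminkowski _ mf mg _)) ?leeD// lee_fin; lra.
- move=> f a b [mf Nf] ab; split => //.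
  by rewrite (le_trans Nf)// lee_fin.
move=> n G D c GT GS gD oD cD.
have [g1 N1] := Lnorm_martingale q2 GT GS gD oD cD.
by split => //; exact: measurable_wrt_measurable g1.
Qed.

Lemma sub_gaussian_gauge (disp : measure_display) (T : measurableType disp)
    (R : realType) (P : probability T R) :
  martingale_gauge P +oo%E (sub_gaussian P) 1.
Proof.
split => //.
- split=> // c c0 l.
  under eq_integral do rewrite mulr0 expR0.
  rewrite integral_cst// mul1e (le_trans (probability_le1 P measurableT))//.
  rewrite lee_fin -[leLHS]expR0 ler_expR; have := sqr_ge0 l; have := sqr_ge0 c.
  by move=> h1 h2; rewrite divr_ge0// mulr_ge0.
- exact: sub_gaussianD.
- move=> f a b [mf a0 fa] ab; split=> //; first exact: le_trans ab.
  by move=> c bc; apply: fa; exact: le_lt_trans bc.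
move=> n G D c GT GS gD oD cD; rewrite mul1r.
have cD' j : (j < n)%N -> \forall x \ae P, `|D j x| <= c j.
  move=> /cD; rewrite unlock ifT; first by move/ess_supP.
  have := probability_setT P; rewrite /= => ->; exact: lte01.
have [g1 _ N1] := mgf_martingale GT GS gD oD cD'.
have s0 : 0 <= \sum_(j < n) c j ^+ 2 by apply: sumr_ge0 => j _; exact: sqr_ge0.
split=> //; first exact: measurable_wrt_measurable g1.
move=> c' cc' l; apply: (le_trans (N1 l)); rewrite lee_fin ler_expR.
rewrite ler_pM2r// ler_wpM2l ?sqr_ge0//.
have c'0 : 0 <= c' by exact: le_trans (sqrtr_ge0 _) (ltW cc').
by rewrite -(sqr_sqrtr s0) lerXn2r ?nnegrE ?sqrtr_ge0// ltW.
Qed.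

Theorem theorem1 (disp : measure_display) (T : measurableType disp)
  (R : realType) (P : probability T R)
  (d : nat) (d_gt0 : (0 < d)%N)
  (N : 'I_d -> nat) (N_gt0 : forall i, (0 < N i)%N)
  (delta : nat -> nat) (delta0 : delta 0%N = 0%N)
  (delta_nondecreasing : forall m n : nat, (m <= n)%N -> (delta m <= delta n)%N)
  (delta_sum : \sum_(1 <= k < (max_log N).+1) (delta k)%:R / 2 ^+ k
               <= 1 / (4 * d%:R ^+ 2) :> R)
  (p : \bar R) (p_ge2 : (2%:E <= p)%E)
  (X : site d -> {RV P >-> R})
  (X_integrable : forall t, P.-integrable setT (EFin \o X t))
  (M : R) (phi : nat -> R)
  (X_WD : WD P X p M phi)
  (* the instance r = 0 of the weak dependence inequality *)
  (X_WD0 : forall t,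
    ('N[P]_p[EFin \o centered P (X t)] <= (M * phi 0%N)%:E)%E) :
  ((p < +oo)%E ->
     ('N[P]_p[EFin \o rect_sum P X N]
        <= (4 * Num.sqrt (fine p) * Psi N delta M phi)%:E)%E) /\
  (p = +oo%E ->
     (subgaussian_norm P (rect_sum P X N) <= (10 * Psi N delta M phi)%:E)%E).
Proof.
split => [py|pE].
  case: p p_ge2 X_WD X_WD0 py => [q||] // p2 X_WD X_WD0 _.
  have q2 : 2 <= q by rewrite -lee_fin.
  have [_] := rect_bound p2 (Lnorm_gauge P q2) d_gt0 delta0 delta_nondecreasing
    delta_sum X_integrable X_WD X_WD0.
  by rewrite /= (_ : 4 * Num.sqrt q = 2 * (2 * Num.sqrt q))//; ring.
rewrite pE in p_ge2 X_WD X_WD0.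
(* The gauge constant is 1, so the bound obtained is 2 [Psi]; nonnegativity of [Psi] turns it into
   10 [Psi]. *)
have Psi0 := Psi_ge0 N delta X_WD X_WD0.
have := rect_bound p_ge2 (sub_gaussian_gauge P) d_gt0 delta0 delta_nondecreasing
  delta_sum X_integrable X_WD X_WD0.
by move=> /subgaussian_norm_le /le_trans; apply; rewrite lee_fin; lra.
Qed.
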